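(* Let $R$ be a nonzero ring. The abstract elementary class $({}_R\mathrm{Flat}, \leq_{Pure})$ of flat left $R$-modules with pure embeddings is superstable if and only if $R$ is left perfect.
   Context: Rings are associative with unity; ${}_R\mathrm{Flat}$ is the class of flat left $R$-modules; $A \leq_{Pure} B$ means that $A$ is a pure submodule of $B$; $\|A\|$ is the cardinality of $A$. A ring $R$ is left perfect if every flat left $R$-module is cotorsion, where $C$ is cotorsion if $\operatorname{Ext}^1_R(F,C) = 0$ for every flat module $F$. For an abstract elementary class $\mathbf{K} = (K, \leq)$ of modules with L\''owenheim-Skolem number $\operatorname{LS}(\mathbf{K})$ (here $\operatorname{card}(R) + \aleph_0$), a $\mathbf{K}$-embedding is an injective homomorphism $f: M \to N$ between members of $K$ with $f[M] \leq N$. For $N \leq M$ with $\|N\| = \|M\| = \lambda$, $M$ is universal over $N$ if for every $N^* \in K$ with $N \leq N^*$ and $\|N^*\| \leq \lambda$ there is a $\mathbf{K}$-embedding $N^* \to M$ which is the identity on $N$. For an infinite cardinal $\lambda$, $M$ is a $\lambda$-limit model if there are a limit ordinal $\alpha < \lambda^+$ and a $\leq$-increasing continuous chain $\{M_i : i < \alpha\}$ of members of $K$ of cardinality $\lambda$ with $M = \bigcup_{i<\alpha} M_i$ and $M_{i+1}$ universal over $M_i$ for each $i < \alpha$. $\mathbf{K}$ is superstable if there is a cardinal $\mu \geq \operatorname{LS}(\mathbf{K})$ such that for every $\lambda \geq \mu$ there is a $\lambda$-limit model and it is unique up to isomorphism. *)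

(* Defs.v *)
From HB Require Import structures.
From mathcomp Require Import all_boot all_algebra.
From mathcomp Require Import ring_quotient.
From mathcomp Require Import boolp classical_sets functions cardinality wochoice.
From mathcomp Require Import freeg.

Set Implicit Arguments.
Unset Strict Implicit.
Unset Printing Implicit Defensive.

Import GRing.Theory.

Local Open Scope ring_scope.

(* Left R-modules are [lmodType R], right R-modules are [lmodType R^c]; for   *)
(* x in a right module, (r : R^c) *: x is the right action x r.               *)

Section Submodules.
Variables (R : nzRingType) (M : lmodType R).

Record submod (S : submodClosed M) :=
  Submod { submod_val : M; submod_valP : submod_val \in S }.

HB.instance Definition _ S := [isSub for @submod_val S].
HB.instance Definition _ S := [Choice of submod S by <:].
HB.instance Definition _ S := [SubChoice_isSubLmodule of submod S by <:].

(* S :&: T, seen as a submodule of the module T. *)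
Definition trace (T S : submodClosed M) : {pred submod T} :=
  [pred x | val x \in S].
Arguments trace : clear implicits.

Lemma trace_submod_closed (T S : submodClosed M) :
  GRing.submod_closed (trace T S).
Proof.
split=> [|a x y xS yS]; first by rewrite inE /= rpred0.
by rewrite inE /= rpredD ?rpredZ.
Qed.

HB.instance Definition _ (T S : submodClosed M) :=
  GRing.isSubmodClosed.Build R (submod T) (trace T S)
    (trace_submod_closed T S).

End Submodules.

Arguments trace {R M} T S.

Section LinearImage.
Variables (R : nzRingType) (M N : lmodType R) (f : {linear M -> N}).

Definition lin_image : {pred N} := [pred y | `[< exists x, f x = y >]].

Lemma lin_image_submod_closed : GRing.submod_closed lin_image.
Proof.
split=> [|a x y /asboolP[u <-] /asboolP[v <-]].
  by apply/asboolP; exists 0; rewrite raddf0.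
by apply/asboolP; exists (a *: u + v); rewrite linearP.
Qed.

HB.instance Definition _ :=
  GRing.isSubmodClosed.Build R N lin_image lin_image_submod_closed.

End LinearImage.

Section Tensor.
Variables (R : nzRingType) (X : lmodType R^c) (M : lmodType R).

Inductive tensor_relator : {freeg (X * M)%type / int} -> Prop :=
| TensorAddl x x' m :
    tensor_relator (<< (x + x', m) >> - << (x, m) >> - << (x', m) >>)
| TensorAddr x m m' :
    tensor_relator (<< (x, m + m') >> - << (x, m) >> - << (x, m') >>)
| TensorBal x (r : R) m :
    tensor_relator (<< ((r : R^c) *: x, m) >> - << (x, r *: m) >>).

(* The subgroup generated by the relators. *)
Definition tensor_rel : {pred {freeg (X * M)%type / int}} :=
  [pred z | `[< forall S : zmodClosed {freeg (X * M)%type / int},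
                (forall w, tensor_relator w -> w \in S) -> z \in S >]].

Lemma tensor_rel_zmod_closed : zmod_closed tensor_rel.
Proof.
split=> [|z w /asboolP hz /asboolP hw]; apply/asboolP => S hS.
  exact: rpred0.
by rewrite rpredB ?hz ?hw.
Qed.

HB.instance Definition _ :=
  GRing.isZmodClosed.Build {freeg (X * M)%type / int} tensor_rel
    tensor_rel_zmod_closed.

Definition tensor := {ideal_quot tensor_rel}.
HB.instance Definition _ := GRing.Zmodule.on tensor.

Definition tens (x : X) (m : M) : tensor := \pi_tensor%qT << (x, m) >>.

End Tensor.

Arguments tensor_rel {R} X M.

Section TensorMap.
Variables (R : nzRingType) (X Y : lmodType R^c) (M N : lmodType R).
Variables (f : {linear X -> Y}) (g : {linear M -> N}).

Definition tensor_gen_map (z : {freeg (X * M)%type / int}) :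
    {freeg (Y * N)%type / int} :=
  fglift (fun p : X * M => << (f p.1, g p.2) >>) z.

Definition tensor_map (z : tensor X M) : tensor Y N :=
  \pi_(tensor Y N)%qT (tensor_gen_map (repr z)).

Lemma tensor_gen_mapB : {morph tensor_gen_map : z w / z - w}.
Proof. exact: lift_is_additive. Qed.

Lemma tensor_gen_mapU x m : tensor_gen_map << (x, m) >> = << (f x, g m) >>.
Proof. by rewrite /tensor_gen_map liftU scale1r. Qed.

Lemma tensor_gen_map_rel z :
  z \in tensor_rel X M -> tensor_gen_map z \in tensor_rel Y N.
Proof.
move=> /asboolP hz; apply/asboolP => S hS.
pose P : {pred {freeg (X * M)%type / int}} := [pred w | tensor_gen_map w \in S].
have Pz : zmod_closed P.
  split=> [|u v uP vP]; last by rewrite inE /= tensor_gen_mapB rpredB.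
  by rewrite inE /= -(subrr 0) tensor_gen_mapB subrr rpred0.
pose PS := HB.pack_for (zmodClosed {freeg (X * M)%type / int}) P
  (GRing.isZmodClosed.Build {freeg (X * M)%type / int} P Pz).
have hPS w : tensor_relator w -> tensor_gen_map w \in S.
  case=> [x x' m|x m m'|x r m].
  - rewrite 2!tensor_gen_mapB 3!tensor_gen_mapU (linearD f).
    exact: hS (TensorAddl _ _ _).
  - rewrite 2!tensor_gen_mapB 3!tensor_gen_mapU (linearD g).
    exact: hS (TensorAddr _ _ _).
  rewrite tensor_gen_mapB 2!tensor_gen_mapU (linearZ_LR f) (linearZ_LR g).
  exact: hS (TensorBal _ _ _).
exact: (hz PS hPS).
Qed.

Lemma pi_tensor_eq (z w : {freeg (X * M)%type / int}) :
  (\pi_(tensor X M)%qT z == \pi_(tensor X M)%qT w) = (z - w \in tensor_rel X M).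
Proof. by rewrite -Quotient.idealrBE. Qed.

End TensorMap.

Section TensorMapTheory.
Variables (R : nzRingType) (X Y : lmodType R^c) (M N : lmodType R).
Variables (f : {linear X -> Y}) (g : {linear M -> N}).

Lemma tensor_map_pi z :
  tensor_map f g (\pi_(tensor X M)%qT z) =
  \pi_(tensor Y N)%qT (tensor_gen_map f g z).
Proof.
apply/eqP; rewrite pi_tensor_eq -tensor_gen_mapB tensor_gen_map_rel //.
by rewrite -pi_tensor_eq reprK.
Qed.

Lemma tensor_mapE x m : tensor_map f g (tens x m) = tens (f x) (g m).
Proof. by rewrite /tens tensor_map_pi tensor_gen_mapU. Qed.

Lemma tensor_mapB : {morph tensor_map f g : z w / z - w}.
Proof.
move=> z w; rewrite -[z]reprK -[w]reprK -raddfB.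
by rewrite !tensor_map_pi tensor_gen_mapB raddfB.
Qed.

End TensorMapTheory.

Section FlatPure.
Variable R : nzRingType.

Definition flat (F : lmodType R) : Prop :=
  forall (X Y : lmodType R^c) (f : {linear X -> Y}),
    injective f -> injective (tensor_map f (idfun : {linear F -> F})).

(* S is pure in M when X (x) S -> X (x) M is injective for every right X. *)
Definition pure (M : lmodType R) (S : submodClosed M) : Prop :=
  forall X : lmodType R^c,
    injective (tensor_map (idfun : {linear X -> X})
                          (val : {linear submod S -> M})).

End FlatPure.

(* Ext^1(F, C) as the set of classes of extensions 0 -> C -> E -> F -> 0;     *)
(* its zero is the class of the split extension C x F.                        *)
Section Ext.
Variables (R : nzRingType) (F C : lmodType R).

Record extension := Extension {
  ext_mid : lmodType R;
  ext_in : {linear C -> ext_mid};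
  ext_out : {linear ext_mid -> F};
  ext_in_inj : injective ext_in;
  ext_out_surj : forall y, exists x, ext_out x = y;
  ext_exact : forall x, ext_out x = 0 <-> exists c, ext_in c = x }.

Definition ext_equiv (E E' : extension) : Prop :=
  exists h : {linear ext_mid E -> ext_mid E'},
    (forall c, h (ext_in E c) = ext_in E' c) /\
    (forall x, ext_out E' (h x) = ext_out E x).

Definition split_in (c : C) : (C * F)%type := (c, 0).

Lemma split_in_linear : linear split_in.
Proof. by move=> a x y; apply: injective_projections; rewrite //= scaler0 addr0. Qed.

HB.instance Definition _ :=
  GRing.isLinear.Build R C (C * F)%type *:%R split_in split_in_linear.

Lemma split_in_inj : injective split_in.
Proof. by move=> x y []. Qed.

Lemma split_out_surj (y : F) : exists x : (C * F)%type, x.2 = y.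
Proof. by exists (0, y). Qed.

Lemma split_exact (x : (C * F)%type) : x.2 = 0 <-> exists c, split_in c = x.
Proof. by case: x => c y /=; split=> [->|[c' [_ <-]]//]; exists c. Qed.

Definition split_extension : extension :=
  @Extension (C * F)%type split_in (snd : {linear (C * F)%type -> F})
    split_in_inj split_out_surj split_exact.

Definition Ext1_eq0 : Prop := forall E : extension, ext_equiv E split_extension.

End Ext.

Definition cotorsion (R : nzRingType) (C : lmodType R) : Prop :=
  forall F : lmodType R, flat F -> Ext1_eq0 F C.

Definition left_perfect (R : nzRingType) : Prop :=
  forall F : lmodType R, flat F -> cotorsion F.

Local Open Scope classical_set_scope.
Local Open Scope card_scope.

(* A class of modules with a notion of strong submodule; aec_sub S is only    *)
(* meaningful when M and S are both in the class, see [aec_le].               *)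
Record aec_data (R : nzRingType) := AecData {
  aec_mem : lmodType R -> Prop;
  aec_sub : forall M : lmodType R, submodClosed M -> Prop }.

Section Aec.
Variables (R : nzRingType) (K : aec_data R).

Definition aec_le (M : lmodType R) (S : submodClosed M) : Prop :=
  [/\ aec_mem K M, aec_mem K (submod S) & aec_sub K S].

Definition aec_embedding (M N : lmodType R) (f : {linear M -> N}) : Prop :=
  [/\ aec_mem K M, injective f & aec_le (lin_image f)].

(* Cardinals are represented by choiceTypes, whose carriers live in the same  *)
(* universe as the carriers of the modules.                                   *)
Definition has_card (lam : choiceType) (M : lmodType R) : Prop :=
  [set: M] #= [set: lam].

(* An extension N <= N' is given, up to isomorphism over N, by an embedding   *)
(* g of N; "identity on N" is then the equation f \o g = val.                 *)
Definition universal_over (lam : choiceType) (M : lmodType R)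
    (N : submodClosed M) : Prop :=
  [/\ aec_le N, has_card lam M, has_card lam (submod N) &
    forall (N' : lmodType R) (g : {linear submod N -> N'}),
      aec_embedding g -> [set: N'] #<= [set: lam] ->
      exists f : {linear N' -> M},
        aec_embedding f /\ forall x, f (g x) = val x].

(* Ordinals are represented by well-ordered types (I, le). *)
Section Index.
Variables (I : choiceType) (le : rel I).

Definition slt (i j : I) : bool := (i != j) && le i j.

Definition limit_order : Prop :=
  [/\ well_order le, inhabited I & forall i, exists j, slt i j].

Definition is_succ (i j : I) : Prop :=
  slt i j /\ forall k, slt i k -> le j k.

Definition is_limit (j : I) : Prop :=
  (exists i, slt i j) /\ forall i, slt i j -> exists k, slt i k /\ slt k j.

End Index.

Definition limit_model (lam : choiceType) (M : lmodType R) : Prop :=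
  exists (I : choiceType) (le : rel I) (N : I -> submodClosed M),
    [/\ limit_order le /\ [set: I] #<= [set: lam],
        forall i, aec_mem K (submod (N i)) /\ has_card lam (submod (N i)),
        forall i j, le i j ->
          {subset N i <= N j} /\ aec_le (trace (N j) (N i)),
        forall j, is_limit le j ->
          forall x, x \in N j -> exists i, slt le i j /\ x \in N i &
        (forall x, exists i, x \in N i) /\
        (forall i j, is_succ le i j ->
          universal_over lam (trace (N j) (N i)))].

Definition module_iso (M N : lmodType R) : Prop :=
  exists f : {linear M -> N}, bijective f.

(* LS(K) = card(R) + aleph_0 *)
Definition superstable : Prop :=
  exists mu : choiceType, [set: (R + nat)%type] #<= [set: mu] /\
    forall lam : choiceType, [set: mu] #<= [set: lam] ->
      (exists M, limit_model lam M) /\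
      (forall M M', limit_model lam M -> limit_model lam M' -> module_iso M M').

End Aec.

Definition flat_pure (R : nzRingType) : aec_data R :=
  AecData (@flat R) (@pure R).

(* Main.v *)
Require Import Defs.
From HB Require Import structures.
From mathcomp Require Import all_boot all_algebra.
From mathcomp Require Import ring_quotient.
From mathcomp Require Import boolp classical_sets functions cardinality wochoice.
From mathcomp Require Import freeg.

(** Why the theorem holds.

Flatness and purity are first restated as solvability of linear equations.  A
module F is flat iff every relation r g = 0 between a row r over R and a tuple
g of elements of F has the form g = L y with r L = 0 ([flatP]); the embedding
of a submodule S of a flat module is pure iff a system s = A h with s in S
that is solvable in the module is solvable in S ([pure_eqpure],
[eqpure_pure]).

If R is left perfect, a pure submodule of a flat module is a direct summand
([perfect_retraction]) and a flat module is a retract of a free one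
([retract_cover]).  Hence the free module W on lam x nat, filtered by the free
submodules on lam x {0..n}, is a lam-limit model ([free_limit_model]).
Conversely every lam-limit model M contains W purely, so M is K + W with K a
retract of the free module on lam, and the Eilenberg swindle gives K + W = W
([eilenberg_swindle], [limit_model_free]).

The other implication goes through the descending chain condition on finitely
generated right submodules of the modules R^m, stated for column spaces of
matrices in [mx_dcc].  Suppose that M_n.+1 = M_n L_n is a strictly descending
chain.  Take for lam the sum of the iterated power sets of a large cardinal
mu, so that the product of the sets tower mu n.+1 does not inject into lam
([koenig]).  A lam-limit model provides modules A, B, C of size lam with B
universal over A and C universal over B; in particular B contains purely a
free module of rank lam.  For a point xi of the product let x_n be a tuple of
distinct basis elements labelled by xi n.  The equations y_n = x_n + L_n y_n.+1
are solvable in a pure extension of B of size at most lam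
([solving_extension]), hence in C.  Two different points xi and eta share the
value y_0, and at the first n where they differ M_n (x_n - x'_n) lies in
M_n.+1 C^k.  Purity and a look at coordinates turn this into M_n = M_n.+1 N, a
contradiction ([universal_map_no_chain]).

Finally [mx_dcc] makes every flat quotient map split, which makes all
extensions of flat modules trivial ([flat_complement], [dcc_left_perfect]).
This is a transfinite induction by countable steps: a tuple g of elements of a
flat module has a minimal column space M R^k such that g lies in M F^k, and
these minimal matrices form Mittag-Leffler systems along which elements can be
lifted. *)

Set Implicit Arguments.
Unset Strict Implicit.
Unset Printing Implicit Defensive.

Import GRing.Theory.

Local Open Scope classical_set_scope.
Local Open Scope ring_scope.
Local Open Scope card_scope.

(** * Matrices acting on tuples of module elements *)

Notation tup M k := {ffun 'I_k -> M}.

Section MatrixAction.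
Variables (R : nzRingType) (M : lmodType R).
Implicit Types (m n k : nat).

Definition mxact m k (A : 'M[R]_(m, k)) (h : tup M k) : tup M m :=
  [ffun i => \sum_j A i j *: h j].

Local Notation "A *v h" := (mxact A h) (at level 40, left associativity).

Lemma tupD m (g h : tup M m) i : (g + h) i = g i + h i.
Proof. by rewrite ffunE. Qed.

Lemma tupN m (g : tup M m) i : (- g) i = - g i.
Proof. by rewrite ffunE. Qed.

Lemma tupB m (g h : tup M m) i : (g - h) i = g i - h i.
Proof. by rewrite tupD tupN. Qed.

Lemma mxactA m k n (A : 'M[R]_(m, k)) (B : 'M[R]_(k, n)) h :
  (A *m B) *v h = A *v (B *v h).
Proof.
apply/ffunP => i; rewrite !ffunE.
under eq_bigr do rewrite mxE scaler_suml.
rewrite exchange_big /=; apply: eq_bigr => j _.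
by rewrite ffunE scaler_sumr; apply: eq_bigr => l _; rewrite scalerA.
Qed.

Lemma mxactDr m k (A : 'M[R]_(m, k)) h h' : A *v (h + h') = A *v h + A *v h'.
Proof.
apply/ffunP => i; rewrite !ffunE -big_split /=.
by apply: eq_bigr => j _; rewrite ffunE scalerDr.
Qed.

Lemma mxactNr m k (A : 'M[R]_(m, k)) h : A *v (- h) = - (A *v h).
Proof.
apply/ffunP => i; rewrite !ffunE -sumrN.
by apply: eq_bigr => j _; rewrite ffunE scalerN.
Qed.

Lemma mxactBr m k (A : 'M[R]_(m, k)) h h' : A *v (h - h') = A *v h - A *v h'.
Proof. by rewrite mxactDr mxactNr. Qed.

Lemma mxact0r m k (A : 'M[R]_(m, k)) : A *v 0 = 0.
Proof. by rewrite -[0](subrr 0) mxactBr subrr. Qed.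

Lemma mxactNl m k (A : 'M[R]_(m, k)) h : (- A) *v h = - (A *v h).
Proof.
apply/ffunP => i; rewrite !ffunE -sumrN.
by apply: eq_bigr => j _; rewrite mxE scaleNr.
Qed.

Lemma mxact0l m k (h : tup M k) : (0 : 'M[R]_(m, k)) *v h = 0.
Proof.
by apply/ffunP => i; rewrite !ffunE big1 // => j _; rewrite mxE scale0r.
Qed.

Lemma mxact1 k (h : tup M k) : 1%:M *v h = h.
Proof.
apply/ffunP => i; rewrite !ffunE (bigD1 i) //= big1 => [|j ji].
  by rewrite mxE eqxx scale1r addr0.
by rewrite mxE eq_sym (negPf ji) scale0r.
Qed.

Definition catv m n (g : tup M m) (h : tup M n) : tup M (m + n) :=
  [ffun i => match fintype.split i with inl j => g j | inr j => h j end].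

Lemma catv_l m n (g : tup M m) (h : tup M n) i : catv g h (lshift n i) = g i.
Proof. by rewrite ffunE (unsplitK (inl i)). Qed.

Lemma catv_r m n (g : tup M m) (h : tup M n) i : catv g h (rshift m i) = h i.
Proof. by rewrite ffunE (unsplitK (inr i)). Qed.

Lemma mxact_row m n k (A : 'M[R]_(k, m)) (B : 'M[R]_(k, n)) g h :
  row_mx A B *v catv g h = A *v g + B *v h.
Proof.
apply/ffunP => i; rewrite !ffunE big_split_ord /=; congr (_ + _).
  by apply: eq_bigr => j _; rewrite catv_l row_mxEl.
by apply: eq_bigr => j _; rewrite catv_r row_mxEr.
Qed.

Lemma mxact_col m n k (A : 'M[R]_(m, k)) (B : 'M[R]_(n, k)) h :
  col_mx A B *v h = catv (A *v h) (B *v h).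
Proof.
apply/ffunP => i; rewrite !ffunE; case: split_ordP => j ->; rewrite ffunE.
  by apply: eq_bigr => l _; rewrite col_mxEu.
by apply: eq_bigr => l _; rewrite col_mxEd.
Qed.

Lemma catv_inj m n (g g' : tup M m) (h h' : tup M n) :
  catv g h = catv g' h' -> g = g' /\ h = h'.
Proof.
move=> e; split; apply/ffunP => i.
  by rewrite -(catv_l g h) e catv_l.
by rewrite -(catv_r g h) e catv_r.
Qed.

Definition all_in (D : set M) m (g : tup M m) := forall i, D (g i).

End MatrixAction.

Notation "A *v h" := (mxact A h) (at level 40, left associativity).

Section Vmap.
Variables (R : nzRingType) (M N : lmodType R) (f : {linear M -> N}).

Definition vmap m (g : tup M m) : tup N m := [ffun i => f (g i)].

Lemma vmapM m k (A : 'M[R]_(m, k)) h : vmap (A *v h) = A *v vmap h.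
Proof.
apply/ffunP => i; rewrite !ffunE linear_sum; apply: eq_bigr => j _.
by rewrite ffunE linearZ.
Qed.

Lemma vmapB m (g h : tup M m) : vmap (g - h) = vmap g - vmap h.
Proof. by apply/ffunP => i; rewrite !ffunE raddfB. Qed.

Lemma vmapD m (g h : tup M m) : vmap (g + h) = vmap g + vmap h.
Proof. by apply/ffunP => i; rewrite !ffunE raddfD. Qed.

Lemma vmap0 m : vmap (0 : tup M m) = 0.
Proof. by apply/ffunP => i; rewrite !ffunE raddf0. Qed.

Lemma vmap_inj m : injective f -> injective (@vmap m).
Proof.
by move=> fi g h /ffunP e; apply/ffunP => i; apply: fi; have := e i; rewrite !ffunE.
Qed.

Lemma vmap_lift m (h : tup N m) : (forall i, exists x, f x = h i) ->
  exists g, vmap g = h.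
Proof.
by move=> /choice[g gE]; exists (finfun g); apply/ffunP => i; rewrite !ffunE.
Qed.

End Vmap.

(** * Submodules, linear maps and quotient modules *)

Lemma linear_pack (R : nzRingType) (M N : lmodType R) (f : M -> N) :
  linear f -> exists g : {linear M -> N}, g =1 f.
Proof.
move=> fL; pose g := HB.pack_for {linear M -> N} f
  (GRing.isLinear.Build R M N *:%R f fL).
by exists g.
Qed.

Section PropSub.
Variables (R : nzRingType) (M : lmodType R).

Definition psub (D : set M) : Prop :=
  D 0 /\ forall a x y, D x -> D y -> D (a *: x + y).

Variable D : set M.
Hypothesis Dsub : psub D.

Lemma psub0 : D 0. Proof. by case: Dsub. Qed.
Lemma psubD x y : D x -> D y -> D (x + y).
Proof. by move=> xD yD; rewrite -[x]scale1r; case: Dsub => _; apply. Qed.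
Lemma psubZ a x : D x -> D (a *: x).
Proof. by move=> xD; rewrite -[_ *: _]addr0; case: Dsub => D0; apply. Qed.
Lemma psubN x : D x -> D (- x).
Proof. by move=> xD; rewrite -scaleN1r; apply: psubZ. Qed.
Lemma psubB x y : D x -> D y -> D (x - y).
Proof. by move=> xD yD; apply: psubD => //; apply: psubN. Qed.
Lemma psub_sum I (r : seq I) (P : pred I) (F : I -> M) :
  (forall i, P i -> D (F i)) -> D (\sum_(i <- r | P i) F i).
Proof. by move=> h; elim/big_ind: _ => //; [exact: psub0|exact: psubD]. Qed.

Lemma all_in_mxact m k (A : 'M[R]_(m, k)) h : all_in D h -> all_in D (A *v h).
Proof. by move=> hD i; rewrite ffunE; apply: psub_sum => j _; exact: psubZ. Qed.
Lemma all_inD m (g h : tup M m) : all_in D g -> all_in D h -> all_in D (g + h).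
Proof. by move=> gD hD i; rewrite ffunE; exact: psubD. Qed.
Lemma all_inN m (g : tup M m) : all_in D g -> all_in D (- g).
Proof. by move=> gD i; rewrite ffunE; exact: psubN. Qed.
Lemma all_inB m (g h : tup M m) : all_in D g -> all_in D h -> all_in D (g - h).
Proof. by move=> gD hD; apply: all_inD => //; exact: all_inN. Qed.

End PropSub.

Section Lquot.
Variables (R : nzRingType) (M : lmodType R) (S : submodClosed M).

Definition zpred : {pred M} := [pred x | x \in S].

Lemma zpred_closed : zmod_closed zpred.
Proof.
split=> [|x y xS yS]; first by rewrite inE rpred0.
by rewrite inE -scaleN1r rpredD ?rpredZ.
Qed.
HB.instance Definition _ := GRing.isZmodClosed.Build M zpred zpred_closed.

(** The quotient M / S; the quotient group of the library gets a module
structure through representatives. *)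
Definition lquot := {ideal_quot zpred}.
HB.instance Definition _ := GRing.Zmodule.on lquot.

Definition lpi (x : M) : lquot := \pi_lquot%qT x.
Definition lrepr (q : lquot) : M := repr q.

Lemma lreprK q : lpi (lrepr q) = q. Proof. exact: reprK. Qed.

Lemma lpi_eq x y : lpi x = lpi y <-> x - y \in S.
Proof.
have E : (x - y \in S) = (lpi x == lpi y) by exact: (@Quotient.idealrBE M zpred).
by rewrite E; split=> /eqP.
Qed.

Lemma lpiD x y : lpi (x + y) = lpi x + lpi y. Proof. exact: raddfD. Qed.

Definition lq_scale (a : R) (q : lquot) : lquot := lpi (a *: lrepr q).

Lemma lq_scaleE a x : lq_scale a (lpi x) = lpi (a *: x).
Proof.
by apply/lpi_eq; rewrite -scalerBr rpredZ //; apply/lpi_eq; rewrite lreprK.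
Qed.

Lemma lq_scaleA a b q : lq_scale a (lq_scale b q) = lq_scale (a * b) q.
Proof. by rewrite -[q]lreprK !lq_scaleE scalerA. Qed.
Lemma lq_scale1 : left_id 1 lq_scale.
Proof. by move=> q; rewrite -[q]lreprK !lq_scaleE scale1r. Qed.
Lemma lq_scaleDr : right_distributive lq_scale +%R.
Proof.
move=> a q r; rewrite -[q]lreprK -[r]lreprK -lpiD !lq_scaleE.
by rewrite scalerDr lpiD.
Qed.
Lemma lq_scaleDl q : {morph lq_scale^~ q : a b / a + b}.
Proof. by move=> a b; rewrite -[q]lreprK !lq_scaleE scalerDl lpiD. Qed.

HB.instance Definition _ := GRing.Zmodule_isLmodule.Build R lquot
  lq_scaleA lq_scale1 lq_scaleDr lq_scaleDl.

Lemma lpi_linear : linear lpi.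
Proof. by move=> a x y; rewrite lpiD -lq_scaleE. Qed.
HB.instance Definition _ := GRing.isLinear.Build R M lquot *:%R lpi lpi_linear.

Lemma lpi_eq0 x : lpi x = 0 <-> x \in S.
Proof.
have -> : (0 : lquot) = lpi 0 by rewrite linear0.
by rewrite lpi_eq subr0.
Qed.

Lemma lpi_surj q : exists x, lpi x = q.
Proof. by exists (lrepr q); exact: lreprK. Qed.

Variables (N : lmodType R) (f : {linear M -> N}).
Hypothesis fS : forall x, x \in S -> f x = 0.

Definition lq_lift (q : lquot) : N := f (lrepr q).

Lemma lq_liftE x : lq_lift (lpi x) = f x.
Proof.
apply/eqP; rewrite -subr_eq0 -raddfB; apply/eqP/fS.
by apply/lpi_eq; rewrite lreprK.
Qed.

Lemma lq_lift_linear : linear lq_lift.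
Proof.
move=> a q r; rewrite -[q]lreprK -[r]lreprK -linearP !lq_liftE linearP.
by [].
Qed.

End Lquot.

(** Homomorphism theorem.  The factored map is only asserted to exist, because
its value on a class is given by an arbitrary representative. *)
Lemma lq_factor (R : nzRingType) (M N : lmodType R) (S : submodClosed M)
  (f : {linear M -> N}) : (forall x, x \in S -> f x = 0) ->
  exists g : {linear lquot S -> N}, forall x, g (lpi S x) = f x.
Proof.
move=> fS; pose g := HB.pack_for {linear lquot S -> N} (lq_lift (S := S) f)
  (GRing.isLinear.Build R (lquot S) N *:%R _ (lq_lift_linear fS)).
by exists g => x; exact: lq_liftE.
Qed.

Section PropSubmod.
Variables (R : nzRingType) (M : lmodType R) (D : set M) (Dsub : psub D).

Definition psub_pred of psub D : {pred M} := [pred x | `[< D x >]].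

Lemma psub_pred_closed : GRing.submod_closed (psub_pred Dsub).
Proof.
split=> [|a x y /asboolP xD /asboolP yD]; apply/asboolP; first exact: psub0.
by case: Dsub => _; apply.
Qed.
HB.instance Definition _ :=
  GRing.isSubmodClosed.Build R M (psub_pred Dsub) psub_pred_closed.

Lemma psub_predE x : x \in psub_pred Dsub <-> D x.
Proof. by split=> [/asboolP|?] //; apply/asboolP. Qed.

End PropSubmod.

(** * From tensor products to equations *)

Section TensTheory.
Variables (R : nzRingType) (X : lmodType R^c) (M : lmodType R).
Implicit Types (x : X) (m : M).

Lemma tensor_relator_rel w : tensor_relator w -> w \in tensor_rel X M.
Proof. by move=> hw; apply/asboolP => S; apply. Qed.

Lemma tensDl x x' m : tens (x + x') m = tens x m + tens x' m.
Proof.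
rewrite /tens -raddfD; apply/eqP; rewrite pi_tensor_eq opprD addrA.
exact/tensor_relator_rel/TensorAddl.
Qed.

Lemma tensDr x m m' : tens x (m + m') = tens x m + tens x m'.
Proof.
rewrite /tens -raddfD; apply/eqP; rewrite pi_tensor_eq opprD addrA.
exact/tensor_relator_rel/TensorAddr.
Qed.

Lemma tensZ x (r : R) m : tens ((r : R^c) *: x) m = tens x (r *: m).
Proof. by apply/eqP; rewrite pi_tensor_eq; exact/tensor_relator_rel/TensorBal. Qed.

Lemma tens0l m : tens (0 : X) m = 0.
Proof. by apply: (addrI (tens 0 m)); rewrite -tensDl !addr0. Qed.
Lemma tens0r x : tens x (0 : M) = 0.
Proof. by apply: (addrI (tens x 0)); rewrite -tensDr !addr0. Qed.

Lemma tensBl x y m : tens (x - y) m = tens x m - tens y m.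
Proof. by apply: (addIr (tens y m)); rewrite -tensDl !subrK. Qed.

Lemma tens_suml I (r : seq I) (P : pred I) (F : I -> X) m :
  tens (\sum_(i <- r | P i) F i) m = \sum_(i <- r | P i) tens (F i) m.
Proof.
by apply: (big_morph (fun x => tens x m)) => [x y|]; rewrite ?tensDl ?tens0l.
Qed.
Lemma tens_sumr I (r : seq I) (P : pred I) (F : I -> M) x :
  tens x (\sum_(i <- r | P i) F i) = \sum_(i <- r | P i) tens x (F i).
Proof.
by apply: (big_morph (fun m => tens x m)) => [y z|]; rewrite ?tensDr ?tens0r.
Qed.

Lemma pi_tensor0 (z : {freeg (X * M)%type / int}) :
  \pi_(tensor X M)%qT z = 0 <-> z \in tensor_rel X M.
Proof.
rewrite -{2}[z]subr0 -pi_tensor_eq raddf0.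
by split=> /eqP.
Qed.
End TensTheory.

(** The equational form of flatness. *)
Definition eqflat (R : nzRingType) (F : lmodType R) : Prop :=
  forall m (r : 'rV[R]_m) (g : tup F m), r *v g = 0 ->
    exists k (L : 'M[R]_(m, k)) (y : tup F k), g = L *v y /\ r *m L = 0.

(** The equational form of purity, for an arbitrary linear map so that it can
be composed and transported along isomorphisms. *)
Definition eqpure (R : nzRingType) (S M : lmodType R) (f : {linear S -> M}) :=
  forall m k (A : 'M[R]_(m, k)) (s : tup S m) (h : tup M k),
    vmap f s = A *v h -> exists h', s = A *v h'.

Section FromTensor.
Variable R : nzRingType.

Definition rvec m := {ffun 'I_m -> (R^c)^o}.
Definition rdelta m (i : 'I_m) : rvec m := [ffun j => (j == i)%:R].

(** Right exactness of the tensor product for the presentation of R^m / K: the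
balanced map (v + K, x) |-> v x with values in F^m modulo K F is well defined,
and it sends the given tensor to the class of g. *)
Lemma tens_quot_eq0 m (K : submodClosed (rvec m)) (F : lmodType R) (g : tup F m) :
  \sum_i tens (lpi K (rdelta i)) (g i) = 0 ->
  exists k (L : 'M[R]_(m, k)) (y : tup F k),
    g = L *v y /\ forall j, [ffun i => L i j] \in K.
Proof.
pose KF (h : tup F m) := exists k (L : 'M[R]_(m, k)) (y : tup F k),
    h = L *v y /\ forall j, [ffun i => L i j] \in K.
pose vf (v : rvec m) (x : F) : tup F m := [ffun i => (v i : R) *: x].
have KFB u v : KF u -> KF v -> KF (u - v).
  move=> [k [L [y [-> hL]]]] [k' [L' [y' [-> hL']]]].
  exists (k + k')%N, (row_mx L (- L')), (catv y y'); split.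
    by rewrite mxact_row mxactNl.
  move=> j; case: (split_ordP j) => l ->.
    have -> : [ffun i => row_mx L (- L') i (lshift k' l)] = [ffun i => L i l].
      by apply/ffunP => i; rewrite !ffunE row_mxEl.
    exact: hL.
  pose w : rvec m := [ffun i => L' i l].
  suff -> : [ffun i => row_mx L (- L') i (rshift k l)] = (-1) *: w.
    by apply: rpredZ; exact: hL'.
  by apply/ffunP => i; rewrite scaleN1r !ffunE row_mxEr mxE.
have KFv v x : v \in K -> KF (vf v x).
  move=> vK; exists 1%N, (\matrix_(i, j) (v i : R)), [ffun=> x]; split.
    by apply/ffunP => i; rewrite !ffunE big_ord1 mxE ffunE.
  move=> j; rewrite (_ : [ffun _ => _] = v) //.
  by apply/ffunP => i; rewrite ffunE mxE.
have KF0 : KF 0.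
  exists 0%N, 0, 0; split=> [|[]//]; by rewrite mxact0r.
pose Phi : {freeg (lquot K * F)%type / int} -> zmodule (tup F m) :=
  fglift (fun p => (vf (lrepr p.1) p.2 : zmodule (tup F m))).
have PhiB : {morph Phi : z w / z - w} by exact: lift_is_additive.
have PhiU x f : Phi << (x, f) >> = vf (lrepr x) f.
  by rewrite /Phi liftU scale1r.
have Phi0 : Phi 0 = 0 by rewrite -(subrr 0) PhiB subrr.
pose P : {pred {freeg (lquot K * F)%type / int}} := [pred z | `[< KF (Phi z) >]].
have Pz : zmod_closed P.
  split=> [|u v /asboolP uP /asboolP vP]; apply/asboolP.
    by rewrite Phi0.
  by rewrite PhiB; exact: KFB.
pose PS := HB.pack_for (zmodClosed {freeg (lquot K * F)%type / int}) P
  (GRing.isZmodClosed.Build {freeg (lquot K * F)%type / int} P Pz).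
have vfB u v x : vf (u - v) x = vf u x - vf v x.
  by apply/ffunP => i; rewrite !ffunE scalerBl.
have vfZ (a : R) v x : vf ((a : R^c) *: v) x = vf v (a *: x).
  by apply/ffunP => i; rewrite !ffunE scalerA.
have vfr v x y : vf v (x + y) = vf v x + vf v y.
  by apply/ffunP => i; rewrite !ffunE scalerDr.
move=> /esym S0.
have : (\sum_i << (lpi K (rdelta i), g i) >>) \in tensor_rel (lquot K) F.
  by apply/pi_tensor0; rewrite raddf_sum.
move=> /asboolP hP.
have hPS w : tensor_relator w -> KF (Phi w).
  case=> [x x' f|x f f'|x r f]; rewrite !PhiB !PhiU.
  - rewrite -!vfB; apply: KFv; rewrite -addrA -opprD; apply/lpi_eq.
    by rewrite linearD /= !lreprK.
  - by rewrite vfr addrAC addrK subrr.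
  rewrite -vfZ -vfB; apply: KFv; apply/lpi_eq.
  by rewrite linearZ /= !lreprK.
have /asboolP := hP PS (fun w hw => asboolT (hPS w hw)).
have PhiD u v : Phi (u + v) = Phi u + Phi v.
  by rewrite -{1}[v]opprK PhiB -(sub0r v) PhiB Phi0 sub0r opprK.
rewrite (big_morph Phi PhiD Phi0).
under eq_bigr do rewrite PhiU.
move=> hs; rewrite -/(KF g).
have -> : g = \sum_i vf (lrepr (lpi K (rdelta i))) (g i)
      - \sum_i vf (lrepr (lpi K (rdelta i)) - rdelta i) (g i).
  rewrite -sumrB; apply/ffunP => i; rewrite sum_ffunE.
  rewrite (bigD1 i) //= big1 => [|j ji].
    by rewrite !ffunE eqxx addr0 -scalerBl opprB addrC subrK scale1r.
  by rewrite !ffunE -scalerBl opprB addrC subrK eq_sym (negPf ji) scale0r.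
apply: (KFB) => //.
elim/big_ind: _ => [|u v uK vK|i _]; first exact: KF0.
  rewrite -[v]opprK; apply: (KFB) => //; rewrite -[- v]add0r; exact: KFB.
by apply: KFv; apply/lpi_eq; rewrite lreprK.
Qed.

End FromTensor.

Section FlatToEq.
Variable R : nzRingType.

Lemma tensor_map0 (X Y : lmodType R^c) (M N : lmodType R)
  (f : {linear X -> Y}) (g : {linear M -> N}) : tensor_map f g 0 = 0.
Proof. by rewrite -(subrr 0) tensor_mapB subrr. Qed.

Lemma tensor_mapD (X Y : lmodType R^c) (M N : lmodType R)
  (f : {linear X -> Y}) (g : {linear M -> N}) :
  {morph tensor_map f g : z w / z + w}.
Proof.
move=> z w; rewrite -{1}[w]opprK tensor_mapB -(sub0r w) tensor_mapB tensor_map0.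
by rewrite sub0r opprK.
Qed.

Lemma tensor_map_sum (X Y : lmodType R^c) (M N : lmodType R)
  (f : {linear X -> Y}) (g : {linear M -> N}) I (r : seq I) (P : pred I) F :
  tensor_map f g (\sum_(i <- r | P i) F i) =
  \sum_(i <- r | P i) tensor_map f g (F i).
Proof. exact: (big_morph _ (tensor_mapD f g) (tensor_map0 f g)). Qed.

(** Let K be the right submodule of the v in R^m with r v = 0.  Multiplication by
r embeds R^m / K into R, and the sum of the e_i (x) g_i over R^m / K is sent to
1 (x) (r g) = 0.  By flatness it is already zero, so g lies in K F. *)
Lemma flat_eqflat (F : lmodType R) : flat F -> eqflat F.
Proof.
move=> fF m r g rg0.
pose psi (v : rvec R m) : (R^c)^o := \sum_i (r 0 i * (v i : R) : R).
have psiP : linear psi.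
  move=> a u v; rewrite /psi scaler_sumr -big_split /=; apply: eq_bigr => i _.
  by rewrite !ffunE mulrDr; congr (_ + _); rewrite mulrA.
pose psiL := HB.pack_for {linear rvec R m -> (R^c)^o} psi
  (GRing.isLinear.Build R^c (rvec R m) (R^c)^o *:%R psi psiP).
have Ks : psub (fun v => psi v = 0).
  split=> [|a u v u0 v0]; first exact: (raddf0 psiL).
  by rewrite psiP u0 v0 scaler0 addr0.
pose K : submodClosed (rvec R m) := psub_pred Ks.
have [q qE] : exists q : {linear lquot K -> (R^c)^o},
    forall x, q (lpi K x) = psiL x.
  by apply: lq_factor => x /psub_predE.
have qi : injective q.
  move=> u v; rewrite -[u]lreprK -[v]lreprK !qE => /eqP.
  rewrite -subr_eq0 -raddfB => /eqP h; apply/lpi_eq/psub_predE; exact: h.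
have [|k [L [y [gE hL]]]] := @tens_quot_eq0 R m K F g.
  apply: (fF _ _ q qi); rewrite tensor_map_sum tensor_map0.
  under eq_bigr => i _.
    rewrite tensor_mapE qE.
    have -> : psiL (rdelta R i) = (r 0 i : R^c) *: (1 : (R^c)^o).
      rewrite /= /psi (bigD1 i) //= big1 => [|j ji].
        by rewrite ffunE eqxx mulr1 addr0; rewrite /GRing.scale /= /GRing.mul /= mul1r.
      by rewrite ffunE (negPf ji) mulr0.
    rewrite tensZ /=; over.
  rewrite -tens_sumr.
  have := congr1 (fun u : tup F 1 => u ord0) rg0.
  by rewrite !ffunE => ->; rewrite tens0r.
exists k, L, y; split=> //; apply/rowP => j; rewrite !mxE.
have /(psub_predE Ks) e := hL j; apply: (etrans _ e).
by apply: eq_bigr => i _; rewrite ffunE.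
Qed.

(** The tensor sum of the e_i (x) s_i over R^m / A R^k vanishes in the big module
because s = A h there.  By purity it vanishes over S, so s lies in A S^k. *)
Lemma pure_eqpure (M : lmodType R) (S : submodClosed M) :
  pure S -> eqpure (val : {linear submod S -> M}).
Proof.
move=> pS m k A s h sE.
pose psi (v : rvec R k) : rvec R m := [ffun i => \sum_j (A i j * (v j : R) : R)].
have psiP : linear psi.
  move=> a u v; apply/ffunP => i; rewrite !ffunE.
  rewrite scaler_sumr -big_split /=; apply: eq_bigr => j _.
  by rewrite !ffunE mulrDr; congr (_ + _); rewrite mulrA.
pose psiL := HB.pack_for {linear rvec R k -> rvec R m} psi
  (GRing.isLinear.Build R^c (rvec R k) (rvec R m) *:%R psi psiP).
have [k' [L [y [-> hL]]]] : exists k' (L : 'M[R]_(m, k')) (y : tup (submod S) k'),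
    s = L *v y /\ forall j, [ffun i => L i j] \in lin_image psiL.
  apply: tens_quot_eq0; apply: (pS); rewrite tensor_map_sum tensor_map0.
  under eq_bigr => i _.
    rewrite tensor_mapE /=.
    have -> : val (s i) = \sum_j A i j *: h j.
      have := congr1 (fun u : tup M m => u i) sE.
      by rewrite !ffunE.
    rewrite tens_sumr; under eq_bigr do rewrite -tensZ; over.
  rewrite exchange_big big1 //= => j _; rewrite -tens_suml.
  rewrite (_ : \sum_i _ = 0) ?tens0l //.
  under eq_bigr do rewrite -linearZ.
  rewrite -linear_sum; apply/lpi_eq0/asboolP; exists (rdelta R j).
  apply/ffunP => i; rewrite /= ffunE sum_ffunE.
  rewrite (bigD1 j) //= big1 => [|l lj]; last by rewrite ffunE (negPf lj) mulr0.
  rewrite (bigD1 i) //= [X in _ = _ + X]big1 => [|l li].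
    by rewrite !ffunE !eqxx mulr1 !addr0 /GRing.scale /= /GRing.mul /= mul1r.
  by rewrite !ffunE eq_sym (negPf li) scaler0.
have /choice[c cE] : forall j, exists c : rvec R k, psi c = [ffun i => L i j].
  by move=> j; have /asboolP := hL j.
pose C : 'M[R]_(k, k') := \matrix_(i, j) (c j i : R).
exists (C *v y); rewrite -mxactA; congr (_ *v _); apply/matrixP => i j.
have := congr1 (fun u : rvec R m => u i) (cE j).
by rewrite !ffunE mxE => <-; apply: eq_bigr => l _; rewrite mxE.
Qed.

End FlatToEq.

(** * From equations to tensor products *)

Lemma freeg_ext (K : choiceType) (G : zmodType) (a b : {freeg K / int} -> G) z :
  {morph a : x y / x - y} -> {morph b : x y / x - y} ->
  (forall x, x \in dom z -> a << x >> = b << x >>) -> a z = b z.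
Proof.
move=> aB bB ab.
pose aL := HB.pack_for {additive {freeg K / int} -> G} a
  (GRing.isZmodMorphism.Build {freeg K / int} G a aB).
pose bL := HB.pack_for {additive {freeg K / int} -> G} b
  (GRing.isZmodMorphism.Build {freeg K / int} G b bB).
rewrite -[a]/(aL : _ -> _) -[b]/(bL : _ -> _) -[z]freeg_sumE !raddf_sum.
rewrite big_seq [RHS]big_seq; apply: eq_bigr => x /ab e.
by rewrite -[coeff x z]intz -freegU_mulz !raddfMz /= e.
Qed.

Section Psi.
Variables (R : nzRingType) (X : lmodType R^c) (F : lmodType R).

(** The additive extension of x (x) f |-> x l(f).  It takes coefficients
coordinatewise: when l runs through the coordinates of elements of F on a
tuple u, the values of [tpsi] are the coefficients of z on u. *)
Definition tpsi (l : F -> R) (z : {freeg (X * F)%type / int}) : X :=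
  fglift (fun p => ((l p.2 : R^c) *: p.1 : zmodule X)) z.

Lemma tpsiB l : {morph tpsi l : z w / z - w}.
Proof. by move=> z w; exact: (@lift_is_additive _ _ (zmodule X) _ z w). Qed.

Lemma tpsi0 l : tpsi l 0 = 0.
Proof. by have := tpsiB l 0 0; rewrite !subrr. Qed.

Lemma tpsiU l x f : tpsi l << (x, f) >> = (l f : R^c) *: x.
Proof. by rewrite /tpsi liftU scale1r. Qed.

Lemma tpsi_mx k k' (l : F -> 'rV[R]_k) (P : 'M_(k, k')) j z :
  tpsi (fun g => (l g *m P) 0 j) z =
  \sum_i (P i j : R^c) *: tpsi (fun g => l g 0 i) z.
Proof.
apply: (@freeg_ext _ _ _
  (fun z => \sum_i (P i j : R^c) *: tpsi (fun g => l g 0 i) z))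
  => [|u v|[x f] _]; first exact: tpsiB.
  by rewrite -sumrB; apply: eq_bigr => i _; rewrite tpsiB scalerBr.
rewrite tpsiU mxE.
rewrite (_ : (\sum_i l f 0 i * P i j : R^c) = \sum_i ((P i j : R^c) * (l f 0 i : R^c) : R^c)) //.
rewrite scaler_suml; apply: eq_bigr => i _.
by rewrite tpsiU scalerA.
Qed.

(** A concrete form of the vanishing of the tensor z: once the elements of F in s are
expressed on some tuple u, u can be expressed on another tuple u' in such a
way that all the coefficients of z on u' vanish.  The quantification over all
u makes this stable under subtraction, because the second refinement can be
taken after the first. *)
Definition killed (z : {freeg (X * F)%type / int}) : Prop :=
  exists s : seq F, forall k (u : tup F k) (l : F -> 'rV[R]_k),
    (forall g, g \in s -> l g *v u = [ffun=> g]) ->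
    exists k' (P : 'M_(k, k')) (u' : tup F k'), u = P *v u' /\
      forall j, tpsi (fun g => (l g *m P) 0 j) z = 0.

Lemma killed0 : killed 0.
Proof.
exists [::] => k u l _; exists k, 1%:M, u; rewrite mxact1; split=> // j.
exact: tpsi0.
Qed.

Lemma killedB z w : killed z -> killed w -> killed (z - w).
Proof.
move=> [s hs] [s' hs']; exists (s ++ s') => k u l hl.
have [|k1 [P [u1 [uE zP]]]] := hs k u l.
  by move=> g gs; apply: hl; rewrite mem_cat gs.
have [|k2 [Q [u2 [u1E wQ]]]] := hs' k1 u1 (fun g => l g *m P).
  by move=> g gs; rewrite mxactA -uE; apply: hl; rewrite mem_cat gs orbT.
exists k2, (P *m Q), u2; rewrite mxactA -u1E; split=> // j.
under (@eq_fun _ _ (fun g => (l g *m (P *m Q)) 0 j)) do rewrite mulmxA.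
rewrite tpsiB tpsi_mx wQ subr0 big1 // => i _.
by rewrite zP scaler0.
Qed.

(** For an additive relator in the second variable the coordinates of m + m' and
the sum of those of m and m' need not be equal, but their difference
annihilates u, so flatness gives a refinement where it is zero; balancing
relators are treated in the same way. *)
Lemma killed_relator w : eqflat F -> tensor_relator w -> killed w.
Proof.
move=> fF.
have base k (u : tup F k) (r : 'rV_k) : r *v u = 0 ->
    exists k' (P : 'M_(k, k')) (u' : tup F k'), u = P *v u' /\
      forall j, (r *m P) 0 j = 0.
  move=> /fF [k' [P [y [uE rP]]]]; exists k', P, y; split=> // j.
  by rewrite rP mxE.
have actB k (a b : 'rV[R]_k) (u : tup F k) : (a - b) *v u = a *v u - b *v u.
  apply/ffunP => i; rewrite !ffunE -sumrB; apply: eq_bigr => j _.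
  by rewrite !mxE scalerBl.
case=> [x x' m|x m m'|x r m].
- exists [::] => k u l _; exists k, 1%:M, u; rewrite mxact1; split=> // j.
  by rewrite !tpsiB !tpsiU scalerDr addrAC addrK subrr.
- exists [:: m + m'; m; m'] => k u l hl.
  have [|k' [P [u' [uE h]]]] := base k u (l (m + m') - l m - l m').
    rewrite !actB !hl ?inE ?eqxx ?orbT //.
    by apply/ffunP => i; rewrite !ffunE addrAC addrK subrr.
  exists k', P, u'; split=> // j; rewrite !tpsiB !tpsiU -!scalerBl.
  have := h j; rewrite !mulmxBl !mxE => e.
  by rewrite [X in X *: _]e scale0r.
exists [:: r *: m; m] => k u l hl.
have [|k' [P [u' [uE h]]]] := base k u (l (r *: m) - r *: l m).
  rewrite actB -mul_scalar_mx mxactA !hl ?inE ?eqxx ?orbT //.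
  by apply/ffunP => i; rewrite !ffunE big_ord1 [i]ord1 mxE mulr1n ffunE subrr.
exists k', P, u'; split=> // j; rewrite !tpsiB !tpsiU scalerA -scalerBl.
have := h j; rewrite mulmxBl -scalemxAl !mxE => /eqP.
rewrite subr_eq0 => /eqP e.
rewrite [X in X *: _](_ : _ = 0) ?scale0r //; apply/eqP; rewrite subr_eq0.
by apply/eqP; symmetry; exact: e.
Qed.

Lemma rel_killed z : eqflat F -> z \in tensor_rel X F -> killed z.
Proof.
move=> fF /asboolP hz.
pose P : {pred {freeg (X * F)%type / int}} := [pred w | `[< killed w >]].
have Pz : zmod_closed P.
  split=> [|u v /asboolP uP /asboolP vP]; apply/asboolP; first exact: killed0.
  exact: killedB.
pose PS := HB.pack_for (zmodClosed {freeg (X * F)%type / int}) P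
  (GRing.isZmodClosed.Build {freeg (X * F)%type / int} P Pz).
by have /asboolP := hz PS (fun w hw => asboolT (killed_relator fF hw)).
Qed.

Lemma pi_tpsi k (u : tup F k) (l : F -> 'rV[R]_k) z :
  (forall p, p \in dom z -> l p.2 *v u = [ffun=> p.2]) ->
  \pi_(tensor X F)%qT z = \sum_j tens (tpsi (fun g => l g 0 j) z) (u j).
Proof.
move=> hl; apply: (@freeg_ext _ _ _
  (fun z => \sum_j tens (tpsi (fun g => l g 0 j) z) (u j))) => [v w|v w|[x f] xf].
- by rewrite raddfB.
- rewrite -sumrB; apply: eq_bigr => j _; by rewrite tpsiB tensBl.
rewrite -/(tens x f); have := congr1 (fun h : tup F 1 => h 0) (hl _ xf).
rewrite !ffunE /= => e; rewrite -{1}e tens_sumr; apply: eq_bigr => j _.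
by rewrite tpsiU tensZ.
Qed.

End Psi.

Section EqToTensor.
Variable R : nzRingType.

Lemma tpsi_gen_map (X Y : lmodType R^c) (M N : lmodType R)
  (f : {linear X -> Y}) (g : {linear M -> N}) l z :
  tpsi l (tensor_gen_map f g z) = f (tpsi (l \o g) z).
Proof.
apply: (@freeg_ext _ _ (fun z => tpsi l (tensor_gen_map f g z))
  (fun z => f (tpsi (l \o g) z))) => [u v|u v|[x m] _].
- by rewrite tensor_gen_mapB tpsiB.
- by rewrite tpsiB raddfB.
by rewrite tensor_gen_mapU !tpsiU linearZ.
Qed.

(** If the image of z vanishes, the vanishing is witnessed by coordinates on a
tuple u of N ([killed]).  Purity moves u into M without changing the
coordinates, and injectivity of f moves the vanishing of the coefficients from
Y to X. *)
Lemma tensor_map_inj (X Y : lmodType R^c) (M N : lmodType R)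
  (f : {linear X -> Y}) (g : {linear M -> N}) :
  injective f -> injective g -> eqflat N -> eqpure g ->
  injective (tensor_map f g).
Proof.
move=> fi gi fN pg.
suff ker0 z : tensor_map f g z = 0 -> z = 0.
  move=> z w /eqP; rewrite -subr_eq0 -tensor_mapB => /eqP/ker0/eqP.
  by rewrite subr_eq0 => /eqP.
rewrite -[z]reprK tensor_map_pi; set z0 := repr z.
move=> /pi_tensor0 /(rel_killed fN) [s hs].
(* Initial coordinates: the listed elements are their own coordinate system. *)
pose s' := s ++ [seq g p.2 | p <- dom z0].
pose l0 x : 'rV[R]_(size s') := \row_j ((j : nat) == index x s')%:R.
pose u0 : tup N (size s') := [ffun j : 'I__ => nth 0 s' j].
have l0E x : x \in s' -> l0 x *v u0 = [ffun=> x].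
  move=> xs; apply/ffunP => i; rewrite !ffunE.
  have xs' : (index x s' < size s')%N by rewrite index_mem.
  rewrite (bigD1 (Ordinal xs')) //= big1 => [|j ji].
    by rewrite mxE eqxx scale1r ffunE addr0 nth_index.
  by rewrite mxE (negPf (_ : (j : nat) != index x s')) // scale0r.
have [x xs|k [P [u [u0E zP]]]] := hs _ u0 l0.
  by apply: l0E; rewrite mem_cat xs.
pose d := dom z0.
have dP (p : (X * M)%type) : p \in d -> (l0 (g p.2) *m P) *v u = [ffun=> g p.2].
  move=> pd; rewrite mxactA -u0E l0E // mem_cat.
  by apply/orP; right; apply/mapP; exists p.
pose nd (i : 'I_(size d)) : M := (nth (0, 0) d i).2.
have [|h hE] := pg _ _ (\matrix_(i < size d) (l0 (g (nd i)) *m P)) [ffun i => nd i] u.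
  apply/ffunP => i; rewrite !ffunE.
  have := congr1 (fun h : tup N 1 => h 0) (dP (nth (0, 0) d i) (mem_nth _ (ltn_ord i))).
  rewrite !ffunE => <-; apply: eq_bigr => j _; congr (_ *: _).
  by rewrite [RHS]mxE mxE.
rewrite (@pi_tpsi _ _ _ k h (fun m => l0 (g m) *m P)) => [|p pd].
  rewrite big1 // => j _; rewrite (_ : tpsi _ _ = 0) ?tens0l //; apply: fi.
  rewrite raddf0 -(zP j) -(tpsi_gen_map _ _ (fun x => (l0 x *m P) 0 j)).
  by [].
have pi : (index p d < size d)%N by rewrite index_mem.
have := congr1 (fun h : tup M _ => h (Ordinal pi)) hE.
rewrite !ffunE /nd /= nth_index // => e; apply/ffunP => i; rewrite !ffunE.
rewrite [RHS]e; apply: eq_bigr => j _; congr (_ *: _).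
by rewrite [i]ord1 [in RHS]mxE /= nth_index.
Qed.

Lemma eqflat_flat (F : lmodType R) : eqflat F -> flat F.
Proof.
move=> fF X Y f fi; apply: tensor_map_inj => // m k A s h e; exists h.
by rewrite -e; apply/ffunP => i; rewrite ffunE.
Qed.

Lemma flatP (F : lmodType R) : flat F <-> eqflat F.
Proof. by split; [exact: flat_eqflat|exact: eqflat_flat]. Qed.

Lemma eqpure_pure (M : lmodType R) (S : submodClosed M) :
  eqflat M -> eqpure (val : {linear submod S -> M}) -> pure S.
Proof. by move=> fM pS X; apply: tensor_map_inj => //; exact: val_inj. Qed.

End EqToTensor.

(** * Complements under the chain condition *)

(** The descending chain condition on the right submodules M R^k of R^m, as the
existence of minimal elements: M (M L) and M generate the same submodule when
M = M L N. *)
Definition mx_dcc (R : nzRingType) : Prop :=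
  forall m (Q : forall k, 'M[R]_(m, k) -> Prop),
    (exists k M, Q k M) ->
    exists k (M : 'M[R]_(m, k)), Q k M /\
      forall l (L : 'M[R]_(k, l)), Q l (M *m L) -> exists N, M = M *m L *m N.

(** The equational form of the flatness of E / D. *)
Definition flat_mod (R : nzRingType) (E : lmodType R) (D : set E) : Prop :=
  forall m (r : 'rV[R]_m) (g : tup E m), D ((r *v g) 0) ->
    exists k (L : 'M[R]_(m, k)) (y : tup E k), all_in D (g - L *v y) /\ r *m L = 0.

Section Complement.
Variables (R : nzRingType) (E : lmodType R) (K : set E).
Hypotheses (dcc : mx_dcc R) (Ksub : psub K).

Definition plusK (G : set E) : set E := fun x => exists2 c, G c & K (x - c).

Lemma plusK_sub G : psub G -> psub (plusK G).
Proof.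
move=> Gs; split=> [|a x y [c Gc Kc] [d Gd Kd]].
  by exists 0; rewrite ?subr0; exact: psub0.
exists (a *: c + d); first by case: Gs => _; apply.
by rewrite opprD addrACA -scalerBr; case: Ksub => _; apply.
Qed.

Lemma sub_plusK (G : set E) x : G x -> plusK G x.
Proof. by move=> Gx; exists x => //; rewrite subrr; exact: psub0. Qed.

Lemma K_plusK (G : set E) x : psub G -> K x -> plusK G x.
Proof. by move=> Gs Kx; exists 0; rewrite ?subr0; [exact: psub0|]. Qed.

(** The flatness of E / (G + K) is what allows a partial complement of K to be
enlarged. *)
Definition partial_complement (G : set E) : Prop :=
  [/\ psub G, forall x, G x -> K x -> x = 0 & flat_mod (plusK G)].

Section Step.
Variable G : set E.
Hypothesis Gpart : partial_complement G.
Let Gsub : psub G. Proof. by case: Gpart. Qed.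
Let D := plusK G.
Let Dsub : psub D. Proof. exact: plusK_sub. Qed.
Let Dflat : flat_mod D. Proof. by case: Gpart. Qed.

(** M R^b is minimal among the submodules U of R^a such that the tuple M x lies
in U E modulo D. *)
Definition minimal_at a b (M : 'M[R]_(a, b)) (x : tup E b) : Prop :=
  forall l (L : 'M_(b, l)) z, all_in D (M *v x - (M *m L) *v z) ->
    exists N, M = M *m L *m N.

Lemma minimal_exists b (x : tup E b) : exists c (M : 'M[R]_(b, c)) z,
  all_in D (x - M *v z) /\
  forall z', all_in D (x - M *v z') -> minimal_at M z'.
Proof.
have [|c [M [[z xz] hM]]] := dcc (Q := fun k A => exists z, all_in D (x - A *v z)).
  by exists b, 1%:M, x => i; rewrite mxact1 subrr ffunE; exact: psub0.
exists c, M, z; split=> // z' xz' l L w hw; apply: hM; exists w.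
rewrite -(subrK (M *v z') x) -addrA; exact: all_inD.
Qed.

(** The Mittag-Leffler step.  Modulo D one writes x = M' z with M' minimal.  As M
is minimal, M = M M' N, so an error kappa in K made by z can be corrected:
replacing z by z + N kappa changes M M' z by M kappa.  What remains of the error
is in G. *)
Lemma minimal_next a b (M : 'M[R]_(a, b)) x : minimal_at M x ->
  exists t : {c & ('M[R]_(b, c) * tup E c)%type},
    [/\ minimal_at (tagged t).1 (tagged t).2,
        all_in D (x - (tagged t).1 *v (tagged t).2) &
        all_in G (M *v x - (M *m (tagged t).1) *v (tagged t).2)].
Proof.
move=> minM; have [c [M' [z [xz hM']]]] := minimal_exists x.
have [N MN] : exists N, M = M *m M' *m N.
  apply: (minM c M' z); rewrite mxactA -mxactBr.
  exact: all_in_mxact.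
(* The error x - M' z is split into a part gam in G and a part kap in K. *)
have /choice[g gP] : forall i, exists c, G c /\ K ((x - M' *v z) i - c).
  by move=> i; have [d Gd Kd] := xz i; exists d.
pose gam := finfun g; pose kap := x - M' *v z - gam.
have Ggam : all_in G gam by move=> i; rewrite ffunE; case: (gP i).
have Kkap : all_in K kap by move=> i; rewrite !ffunE; case: (gP i); rewrite !ffunE.
have xz' : all_in D (x - M' *v (z + N *v kap)).
  rewrite mxactDr opprD addrA; apply: (all_inB Dsub) => //.
  apply: (all_in_mxact Dsub); apply: (all_in_mxact Dsub) => i; exact: K_plusK.
exists (existT _ c (M', z + N *v kap)); split=> //=; first exact: hM'.
rewrite mxactDr -[_ *v (N *v _)]mxactA -MN opprD addrA mxactA -!mxactBr.
rewrite /kap opprB addrC subrK.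
exact: all_in_mxact.
Qed.

Record mstate := MState { sa : nat; sb : nat; sM : 'M[R]_(sa, sb);
  sx : tup E sb; smin : minimal_at sM sx }.

Lemma mnext_exists (s : mstate) : exists t : {c & ('M[R]_(sb s, c) * tup E c)%type},
  [/\ minimal_at (tagged t).1 (tagged t).2,
      all_in D (sx s - (tagged t).1 *v (tagged t).2) &
      all_in G (sM s *v sx s - (sM s *m (tagged t).1) *v (tagged t).2)].
Proof. by apply: minimal_next; exact: smin. Qed.

Definition mnext s : mstate :=
  MState (let: And3 h _ _ := projT2 (cid (mnext_exists s)) in h).

Lemma mnextD s : all_in D (sx s - sM (mnext s) *v sx (mnext s)).
Proof. by rewrite /mnext /=; case: cid => /= t []. Qed.
Lemma mnextG s : all_in G (sM s *v sx s - (sM s *m sM (mnext s)) *v sx (mnext s)).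
Proof. by rewrite /mnext /=; case: cid => /= t []. Qed.

Section Span.
Variable s0 : mstate.
Definition mst n := iter n mnext s0.
Definition mh n : tup E (sa (mst n)) := sM (mst n) *v sx (mst n).

Lemma mhS n : all_in G (mh n - sM (mst n) *v mh n.+1).
Proof. by rewrite /mh -mxactA; exact: mnextG. Qed.

Lemma sx_mhS n : all_in D (sx (mst n) - mh n.+1).
Proof. exact: mnextD. Qed.

(** G enlarged by the span of all the entries of the tuples h_n.  Modulo G the span
of h_n is contained in that of h_n.+1, so a single n suffices for each
element. *)
Definition mspan : set E := fun e =>
  exists n (t : 'rV_(sa (mst n))), G (e - (t *v mh n) 0).

Lemma row_up n (t : 'rV_(sa (mst n))) :
  G ((t *v mh n) 0 - ((t *m sM (mst n)) *v mh n.+1) 0).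
Proof.
have := all_in_mxact Gsub t (@mhS n) 0.
by rewrite mxactBr -mxactA tupB.
Qed.

Lemma mspan_up n k e (t : 'rV_(sa (mst n))) : G (e - (t *v mh n) 0) ->
  exists t' : 'rV_(sa (mst (k + n))), G (e - (t' *v mh (k + n)) 0).
Proof.
move=> Ge; elim: k => [|k [t' IH]]; first by exists t.
exists (t' *m sM (mst (k + n))).
rewrite -(subrK ((t' *v mh (k + n)) 0) e) -addrA; apply: psubD => //.
exact: (row_up (n := k + n)).
Qed.

Lemma mspan_sub : psub mspan.
Proof.
split=> [|a x y [n [t xt]] [n' [t' yt]]].
  by exists 0%N, 0; rewrite mxact0l ffunE subr0; exact: psub0.
have [u xu] := mspan_up n' xt; have [v yv] := mspan_up n yt.
exists (n' + n)%N; move: v yv; rewrite addnC => v yv.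
exists (a *: u + v).
suff -> : ((a *: u + v) *v mh (n' + n)) 0 =
    a *: (u *v mh (n' + n)) 0 + (v *v mh (n' + n)) 0.
  by rewrite opprD addrACA -scalerBr; case: Gsub => _; apply.
rewrite !ffunE scaler_sumr -big_split; apply: eq_bigr => j _.
by rewrite !mxE scalerDl scalerA.
Qed.

Lemma sub_mspan x : G x -> mspan x.
Proof. by move=> Gx; exists 0%N, 0; rewrite mxact0l ffunE subr0. Qed.

Lemma mh_mspan n : all_in mspan (mh n).
Proof.
move=> i; exists n, (delta_mx 0 i).
rewrite [X in mh n i - X](_ : _ = mh n i); first by rewrite subrr; exact: psub0.
rewrite ffunE (bigD1 i) //= big1 => [|j ji].
  by rewrite mxE !eqxx scale1r addr0.
by rewrite mxE (negPf ji) andbF scale0r.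
Qed.

Lemma sub_plusK_mspan x : D x -> plusK mspan x.
Proof. by case=> c Gc Kc; exists c => //; exact: sub_mspan. Qed.

(** Flatness modulo D replaces x by L y with t M L = 0, and minimality gives
M = M L N. *)
Lemma row_kill n (t : 'rV_(sa (mst n))) : D ((t *v mh n) 0) ->
  t *m sM (mst n) = 0.
Proof.
rewrite /mh -mxactA => /Dflat [k [L [y [xy tL]]]].
have [|N ->] := @smin (mst n) k L y.
  by rewrite mxactA -mxactBr; exact: all_in_mxact.
by rewrite !mulmxA tL mul0mx.
Qed.

(** The intersection with K is controlled by [row_kill].  For flatness, a relation
r g = t h_n modulo D comes from (g, x_n) = (L1, L2) y with r L1 = t M L2, and
minimality M = M L2 N turns t h_n into r (L1 N x_n), where the entries of x_n
are in the enlarged submodule modulo D. *)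
Lemma mspan_partial_complement : partial_complement mspan.
Proof.
split=> [|e [n [t et]] Ke|m r g [c [n [t ct]] rc]]; first exact: mspan_sub.
  have tM : t *m sM (mst n) = 0.
    apply: row_kill; rewrite -[_ 0](subrK e); apply: psubD => //.
      by rewrite -opprB; apply: psubN => //; exact: sub_plusK.
    exact: K_plusK.
  have : G e by move: et; rewrite /mh -mxactA tM mxact0l ffunE subr0.
  by case: Gpart => _ GK _ Ge; exact: GK.
have Drt : D ((r *v g) 0 - (t *v mh n) 0).
  rewrite -(subrK c ((r *v g) 0)) -addrA; apply: psubD => //.
    exact: K_plusK.
  exact: sub_plusK.
pose M := sM (mst n); pose x := sx (mst n).
have /Dflat [k [L [y [hy rL]]]] : D ((row_mx r (- (t *m M)) *v catv g x) 0).
  rewrite mxact_row mxactNl tupB mxactA; exact: Drt.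
have [g1 g2] : all_in D (g - usubmx L *v y) /\ all_in D (x - dsubmx L *v y).
  rewrite -[L]vsubmxK mxact_col in hy.
  split=> i.
    by have := hy (lshift _ i); rewrite !tupB !catv_l.
  by have := hy (rshift _ i); rewrite !tupB !catv_r.
have rtL : r *m usubmx L = t *m M *m dsubmx L.
  move: rL; rewrite -[L]vsubmxK mul_row_col => /eqP.
  by rewrite mulNmx subr_eq0 col_mxKu col_mxKd => /eqP.
have [|N MN] := @smin (mst n) k (dsubmx L) y.
  by rewrite mxactA -mxactBr; exact: all_in_mxact.
(* Now r (g - w) is in D, since r L1 N x = t M x modulo D. *)
pose w := (usubmx L *m N) *v x.
have wspan : all_in (plusK mspan) w.
  apply: (all_in_mxact (plusK_sub mspan_sub)).
  move=> i; rewrite -(subrK (mh n.+1) x) ffunE; apply: (psubD (plusK_sub mspan_sub)).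
    exact/sub_plusK_mspan/sx_mhS.
  exact/sub_plusK/mh_mspan.
have /Dflat [k' [L' [y' [gy' rL']]]] : D ((r *v (g - w)) 0).
  rewrite mxactBr /w -mxactA mulmxA rtL -!mulmxA [_ *m (_ *m N)]mulmxA -MN.
  by rewrite mxactA tupB.
exists k', L', y'; split=> //.
rewrite -(subrK w g) -addrA [w - _]addrC addrA.
apply: (all_inD (plusK_sub mspan_sub)) => // i.
by apply: sub_plusK_mspan; exact: gy'.
Qed.

End Span.

Lemma partial_complement_extend x : ~ D x -> exists2 G', partial_complement G' & G `<` G'.
Proof.
move=> Dx; have [b [M [z [xz minM]]]] := minimal_exists [ffun i : 'I_1 => x].
pose s0 := MState (minM z xz).
exists (mspan s0); first exact: mspan_partial_complement.
split=> [|sG]; first by move=> y; exact: sub_mspan.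
apply: Dx; have := xz 0; rewrite tupB ffunE => h.
 rewrite -(subrK (mh s0 0 0) x); apply: psubD => //.
apply: sub_plusK; apply: sG; exact: mh_mspan.
Qed.

End Step.

(** Zorn's lemma on partial complements: a maximal one must satisfy G + K = E by
[partial_complement_extend]. *)
Theorem flat_complement : flat_mod K ->
  exists G : set E, [/\ psub G, forall x, G x -> K x -> x = 0 &
    forall x, exists2 c, G c & K (x - c)].
Proof.
move=> Kflat.
have part0 : partial_complement [set 0].
  have s0 : psub [set (0 : E)].
    by split=> // a x y -> ->; rewrite scaler0 addr0.
  split=> //.
  move=> m r g [c -> ]; rewrite subr0 => /Kflat [k [L [y [gy rL]]]].
  by exists k, L, y; split=> // i; apply: K_plusK.
(* The empty set is admitted for the sake of the union of the empty chain. *)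
have [F FP sF|G [GP maxG]] := @Zorn_bigcup E (fun G => G = set0 \/ partial_complement G).
  have [[G0 [FG0 G0p]]|noG] := pselect (exists G, F G /\ partial_complement G); last first.
    left; apply/seteqP; split=> // x [G FG Gx].
    have [G0|pG] := FP _ FG; first by rewrite G0 in Gx.
    by case: noG; exists G.
  right.
  have big x : (\bigcup_(X in F) X) x -> exists G, [/\ F G, partial_complement G & G x].
    move=> [G FG Gx]; exists G; split=> //.
    by have [Ge|//] := FP _ FG; rewrite Ge in Gx.
  split.
  - split=> [|a x y /big[G [FG pG Gx]] /big[H [FH pH Hy]]].
      by exists G0 => //; apply: psub0; case: G0p.
    have [GH|HG] := sF _ _ FG FH.
      exists H => //; case: pH => -[_ h] _ _; apply: h => //; exact: GH.
    exists G => //; case: pG => -[_ h] _ _; apply: h => //; exact: HG.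
  - by move=> x /big[G [_ [_ h _] Gx]]; exact: h.
  move=> m r g [c /big[G [FG pG Gc]] Kc].
  case: (pG) => _ _ /(_ m r g) [|k [L [y [gy rL]]]]; first by exists c.
  exists k, L, y; split=> // i; have [d Gd Kd] := gy i.
  by exists d => //; exists G.
have Gpart : partial_complement G.
  case: GP => // G0; have := maxG [set 0]; rewrite G0 => h.
  exfalso; apply: h; last by right.
  split=> //; move=> /(_ 0); apply.
  by [].
exists G; split; try by case: Gpart.
move=> x; apply: contrapT => nx.
have [|G' pG' GG'] := @partial_complement_extend G Gpart x; first exact: nx.
by apply: (maxG G' GG'); right.
Qed.

End Complement.

(** A complement of the image of C in the middle term of an extension of F by C
is a splitting. *)
Lemma dcc_left_perfect (R : nzRingType) : mx_dcc R -> left_perfect R.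
Proof.
move=> dcc C _ F /flat_eqflat Fflat [E i p i_inj p_surj ex].
pose K : set E := fun x => p x = 0.
have Ksub : psub K.
  by split=> [|a x y xK yK]; rewrite /K ?raddf0 // linearP /= xK yK scaler0 addr0.
have Kflat : flat_mod K.
  move=> m r g rg.
  have [|k [L [y [gy rL]]]] := Fflat m r (vmap p g).
    rewrite -vmapM; apply/ffunP => j; rewrite [j]ord1 [LHS]ffunE [RHS]ffunE; exact: rg.
  have [z zE] := vmap_lift (fun j => p_surj (y j)).
  exists k, L, z; split=> // j; rewrite /K.
  have := congr1 (fun h : tup F m => h j) gy.
  rewrite -zE -vmapM [LHS]ffunE [RHS]ffunE => e.
  by rewrite tupB raddfB /= e subrr.
have [G [Gsub GK GKE]] := flat_complement dcc Ksub Kflat.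
have /choice[c cP] : forall x, exists c, G (x - i c).
  move=> x; have [d Gd xd] := GKE x; have [e eE] := (ex _).1 xd.
  by exists e; rewrite eE opprB addrC subrK.
have pi d : p (i d) = 0 by apply/ex; exists d.
have cu x d : G (x - i d) -> c x = d.
  move=> Gd; apply: i_inj; apply/eqP; rewrite -subr_eq0; apply/eqP.
  apply: GK; last by rewrite /K raddfB /= !pi subrr.
  have := psubB Gsub Gd (cP x).
  by rewrite opprB addrA addrC -!addrA addKr addrC.
have cL : linear c.
  move=> a x y; apply: cu.
  rewrite linearP opprD addrACA -scalerBr; case: Gsub => _; apply; exact: cP.
have ci d : c (i d) = d by apply: cu; rewrite subrr; exact: psub0.
have [h hE] : exists h : {linear E -> (C * F)%type}, h =1 (fun x => (c x, p x)).
  by apply: linear_pack => a x y; rewrite cL linearP.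
exists h; split=> [d|x]; rewrite hE //=.
by rewrite ci pi.
Qed.

(** * Cardinal arithmetic *)

Definition inj_le (A B : Type) : Prop := exists f : A -> B, injective f.

Lemma inj_le_refl A : inj_le A A. Proof. by exists id. Qed.
Lemma inj_le_trans B A C : inj_le A B -> inj_le B C -> inj_le A C.
Proof. by move=> [f fi] [g gi]; exists (g \o f); exact: inj_comp. Qed.
Lemma inj_le_prod A B A' B' : inj_le A A' -> inj_le B B' -> inj_le (A * B) (A' * B').
Proof.
move=> [f fi] [g gi]; exists (fun p => (f p.1, g p.2)).
by move=> [a b] [c d] [/fi -> /gi ->].
Qed.
Lemma inj_le_seq A B : inj_le A B -> inj_le (seq A) (seq B).
Proof. by move=> [f fi]; exists (map f); exact: inj_map. Qed.

Lemma inj_le_surj A B (f : A -> B) : (forall b, exists a, f a = b) -> inj_le B A.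
Proof.
by move=> /choice[g gE]; exists g => x y e; rewrite -(gE x) e gE.
Qed.

Lemma card_leTP (A B : Type) : reflect (inj_le A B) ([set: A] #<= [set: B]).
Proof.
apply: (iffP idP) => [/card_leP[f]|[f fi]].
  exists (fun a => set_val (f (SigSub (mem_set (I : [set: A] a))))) => x y.
  move=> /val_inj /(@inj _ _ _ f); rewrite !inE => /(_ I I) e.
  exact: (congr1 set_val e).
have h : f @` [set: A] #= [set: A] by apply: inj_card_eq => x y _ _; exact: fi.
by apply: card_le_trans (card_leT (f @` [set: A])); rewrite card_eq_le in h; case/andP: h.
Qed.

Lemma card_eqTP (A B : Type) :
  inj_le A B -> inj_le B A -> [set: A] #= [set: B].
Proof. by move=> /card_leTP h /card_leTP h'; apply: Cantor_Bernstein. Qed.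

Lemma card_eq_inj_le (A B : Type) : [set: A] #= [set: B] -> inj_le A B.
Proof. by rewrite card_eq_le => /andP[/card_leTP]. Qed.

(** A maximal partial injection is either defined everywhere or onto. *)
Lemma inj_le_total (T U : Type) : inj_le T U \/ inj_le U T.
Proof.
pose P (G : set (T * U)) := (forall t u u', G (t, u) -> G (t, u') -> u = u') /\
  (forall t t' u, G (t, u) -> G (t', u) -> t = t').
have [F FP sF|G [[Gf Gi] maxG]] := @Zorn_bigcup _ P.
  split=> [t u u' [X FX Xu] [Y FY Yu]|t t' u [X FX Xu] [Y FY Yu]].
    have [XY|YX] := sF _ _ FX FY.
      by apply: (proj1 (FP _ FY)) Yu; exact: XY.
    by apply: (proj1 (FP _ FX)) Xu _; exact: YX.
  have [XY|YX] := sF _ _ FX FY.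
    by apply: (proj2 (FP _ FY)) Yu; exact: XY.
  by apply: (proj2 (FP _ FX)) Xu _; exact: YX.
have [/choice[f fG]|/existsNP[t0 ht0]] := pselect (forall t, exists u, G (t, u)).
  by left; exists f => x y e; apply: (Gi _ _ (f x)); [exact: fG|rewrite e; exact: fG].
right; have /choice[f fG] : forall u, exists t, G (t, u).
  move=> u0; apply: contrapT => hu0.
  apply: (maxG (G `|` [set (t0, u0)])).
    split=> [x|]; first by left.
    by move=> /(_ (t0, u0)) h; apply: ht0; exists u0; apply: h; right.
  split=> [t u u' [Gu|[-> ->]] [Gu'|[]]|t t' u [Gu|[-> ->]] [Gu'|[]]] //.
  - exact: Gf Gu Gu'.
  - by move=> e; case: ht0; exists u; rewrite -e.
  - by case: ht0; exists u'.
  - exact: Gi Gu Gu'.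
  - by move=> _ e; case: hu0; exists t; rewrite -e.
  - by case: hu0; exists t'.
by exists f => x y e; apply: (Gf (f x)); [exact: fG|rewrite e; exact: fG].
Qed.

Lemma sval_inj T (P : T -> Prop) : injective (@sval T P).
Proof.
by move=> [x Px] [y Py] /= e; subst y; congr exist; exact: Prop_irrelevance.
Qed.

Section Square.
Variables (T : Type) (e : nat -> T).
Hypothesis e_inj : injective e.

Definition fieldG (G : set (T * T * T)) : set T := fun x => exists t, G ((x, x), t).

(** The graph of an injection A x A -> A, where A = [fieldG G] contains a fixed
countable set. *)
Record good_graph (G : set (T * T * T)) : Prop := GoodGraph {
  gg_fun : forall p t t', G (p, t) -> G (p, t') -> t = t';
  gg_inj : forall p q t, G (p, t) -> G (q, t) -> p = q;
  gg_tot : forall x y, fieldG G x -> fieldG G y -> exists t, G ((x, y), t);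
  gg_cl : forall x y t, G ((x, y), t) -> [/\ fieldG G x, fieldG G y & fieldG G t];
  gg_inf : forall n, fieldG G (e n) }.

Lemma good_graph0 : exists G, good_graph G.
Proof.
pose G : set (T * T * T) := fun p => exists i j,
  p = ((e i, e j), e (pickle (i, j))).
have GA x : fieldG G x <-> exists n, x = e n.
  split=> [[t [i [j [-> _ _]]]]|[n ->]]; first by exists i.
  by exists (e (pickle (n, n))), n, n.
exists G; split.
- by move=> p t t' [i [j [-> ->]]] [k [l [/e_inj -> /e_inj -> ->]]].
- move=> p q t [i [j [-> ->]]] [k [l [-> /e_inj]]].
  by move=> /(pcan_inj pickleK) [-> ->].
- by move=> x y /GA[n ->] /GA[m ->]; exists (e (pickle (n, m))), n, m.
- move=> x y t [i [j [-> -> ->]]]; split; apply/GA; [by exists i|by exists j|].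
  by exists (pickle (i, j)).
by move=> n; apply/GA; exists n.
Qed.

Lemma good_graph_max : exists2 G, good_graph G &
  forall H, G `<` H -> ~ good_graph H.
Proof.
(* The empty set is admitted for the sake of the union of the empty chain. *)
have [F FP sF|G [GP maxG]] := @Zorn_bigcup _ (fun G => G = set0 \/ good_graph G).
  have [[G0 [FG0 G0p]]|noG] := pselect (exists G, F G /\ good_graph G); last first.
    left; apply/seteqP; split=> // x [G FG Gx].
    have [G0|pG] := FP _ FG; first by rewrite G0 in Gx.
    by case: noG; exists G.
  right.
  have big p : (\bigcup_(X in F) X) p -> exists G, [/\ F G, good_graph G & G p].
    move=> [G FG Gx]; exists G; split=> //.
    by have [Ge|//] := FP _ FG; rewrite Ge in Gx.
  have big2 p q : (\bigcup_(X in F) X) p -> (\bigcup_(X in F) X) q ->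
      exists G, [/\ F G, good_graph G, G p & G q].
    move=> /big[G [FG pG Gp]] /big[H [FH pH Hq]].
    have [GH|HG] := sF _ _ FG FH.
      by exists H; split=> //; exact: GH.
    by exists G; split=> //; exact: HG.
  have fieldS G x : F G -> fieldG G x -> fieldG (\bigcup_(X in F) X) x.
    by move=> FG [t Gt]; exists t, G.
  split.
  - by move=> p t t' h h'; have [G [_ gG Gp Gq]] := big2 _ _ h h'; exact: gg_fun gG _ _ _ Gp Gq.
  - by move=> p q t h h'; have [G [_ gG Gp Gq]] := big2 _ _ h h'; exact: gg_inj gG _ _ _ Gp Gq.
  - move=> x y [t tx] [u uy]; have [G [FG gG Gp Gq]] := big2 _ _ tx uy.
    have [v Gv] := gg_tot gG (ex_intro _ _ Gp) (ex_intro _ _ Gq).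
    by exists v, G.
  - move=> x y t /big[G [FG gG Gt]]; have [a b c] := gg_cl gG Gt.
    by split; exact: fieldS FG _.
  by move=> n; apply: fieldS FG0 _; exact: gg_inf.
have gG : good_graph G.
  case: GP => // G0; have [H gH] := good_graph0.
  exfalso; apply: (maxG H); last by right.
  rewrite G0; split=> // H0; have [t /H0] := gg_inf gH 0%N; exact.
by exists G => // H GH gH; apply: (maxG H GH); right.
Qed.

(** Take a maximal injection A x A -> A.  If the complement of A embeds in A, then
T embeds in A x A, hence in A, and so does T x T.  Otherwise A embeds in its
complement by some j, and the injection extends to A and j A, sending every new
pair into j A. *)
Lemma square_inj_le : inj_le (T * T) T.
Proof.
have [G gG maxG] := good_graph_max.
pose A := fieldG G.
have /choice[s0 s0P] : forall p : T * T, exists t, A p.1 -> A p.2 -> G (p, t).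
  move=> [x y]; have [[Ax Ay]|nA] := pselect (A x /\ A y).
    by have [t Gt] := gg_tot gG Ax Ay; exists t.
  by exists x => Ax Ay; case: nA.
pose s x y := s0 (x, y).
have sG x y : A x -> A y -> G ((x, y), s x y) by exact: (s0P (x, y)).
have sA x y : A x -> A y -> A (s x y).
  by move=> Ax Ay; have [] := gg_cl gG (sG x y Ax Ay).
have sI x y x' y' : A x -> A y -> A x' -> A y' -> s x y = s x' y' ->
    x = x' /\ y = y'.
  move=> Ax Ay Ax' Ay' E; have := sG x y Ax Ay; rewrite E => h.
  by have [] := gg_inj gG h (sG _ _ Ax' Ay').
have eA n : A (e n) by exact: gg_inf.
have [[f fi]|[j ji]] := inj_le_total {x | ~ A x} {x | A x}.
  (* The tags e 0 and e 1 separate A from its complement. *)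
  pose c x : T := match pselect (A x) with
    | left _ => s (e 0%N) x
    | right nAx => s (e 1%N) (sval (f (exist _ x nAx)))
    end.
  have cA x : A (c x).
    by rewrite /c; case: pselect => h; apply: sA => //; exact: svalP.
  have ci : injective c.
    move=> x y; rewrite /c; case: pselect => hx; case: pselect => hy.
    - by move=> /(sI _ _ _ _ (eA _) hx (eA _) hy)[].
    - by move=> /(sI _ _ _ _ (eA _) hx (eA _) (svalP _))[/e_inj].
    - by move=> /(sI _ _ _ _ (eA _) (svalP _) (eA _) hy)[/e_inj].
    move=> /(sI _ _ _ _ (eA _) (svalP _) (eA _) (svalP _))[_ E].
    have /fi /(congr1 sval) // : f (exist _ x hx) = f (exist _ y hy).
    exact: sval_inj.
  exists (fun p => s (c p.1) (c p.2)) => -[x y] [x' y'] /=.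
  by move=> /(sI _ _ _ _ (cA _) (cA _) (cA _) (cA _))[/ci -> /ci ->].
(* Otherwise the graph G extends, against its maximality. *)
exfalso.
pose im z := exists a, z = sval (j a).
have imA z : im z -> ~ A z by move=> [a ->]; case: (j a).
(* r projects A and j A back to A; with the tag tau it codes their union. *)
have /choice[r rP] : forall z, exists x, [/\ (A z -> x = z), (A z \/ im z -> A x) &
    forall a, z = sval (j a) -> x = sval a].
  move=> z; have [Az|nAz] := pselect (A z).
    by exists z; split=> [//|//|a za]; by case: (imA z _ Az); exists a.
  have [[a za]|nim] := pselect (im z).
    exists (sval a); split=> // [_|b zb]; first exact: svalP.
    have /ji -> // : j a = j b by apply: sval_inj; rewrite -za zb.
  by exists z; split=> // [[]//|a za]; case: nim; exists a.
pose B z := A z \/ im z.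
have rA z : B z -> A (r z) by case: (rP z).
pose tau z := if pselect (A z) then e 0%N else e 1%N.
have tauA z : A (tau z) by rewrite /tau; case: pselect => ?; exact: eA.
have tau_r z w : B z -> B w -> tau z = tau w -> r z = r w -> z = w.
  have [rz _ rz'] := rP z; have [rw _ rw'] := rP w.
  rewrite /tau; case: pselect => Az; case: pselect => Aw Bz Bw.
  - by rewrite rz // rw.
  - by move=> /e_inj.
  - by move=> /e_inj.
  have [a za] : im z by case: Bz.
  have [b wb] : im w by case: Bw.
  by rewrite (rz' a) // (rw' b) // => _ /sval_inj E; rewrite za wb E.
pose jj a := if pselect (A a) is left Aa then sval (j (exist _ a Aa)) else a.
have jj_im a : A a -> im (jj a).
  by rewrite /jj; case: pselect => // Aa ?; exists (exist _ a Aa).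
have jj_inj a b : A a -> A b -> jj a = jj b -> a = b.
  rewrite /jj; case: pselect => // Aa ?; case: pselect => // Ab ?.
  by move=> /sval_inj /ji /(congr1 sval).
pose code x y := s (s (tau x) (r x)) (s (tau y) (r y)).
have codeA x y : B x -> B y -> A (code x y).
  by move=> Bx By; apply: (sA); apply: (sA) => //; exact: rA.
have code_inj x y x' y' : B x -> B y -> B x' -> B y' ->
    code x y = code x' y' -> x = x' /\ y = y'.
  have cA z : B z -> A (s (tau z) (r z)) by move=> Bz; apply: sA => //; exact: rA.
  have cI z w : B z -> B w -> s (tau z) (r z) = s (tau w) (r w) -> z = w.
    move=> Bz Bw /(sI _ _ _ _ (tauA _) (rA _ Bz) (tauA _) (rA _ Bw))[].
    exact: tau_r.
  move=> Bx By Bx' By'.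
  move=> /(sI _ _ _ _ (cA _ Bx) (cA _ By) (cA _ Bx') (cA _ By'))[].
  by move=> /cI -> // /cI ->.
pose H : set (T * T * T) := fun p => G p \/
  [/\ B p.1.1, B p.1.2, ~ (A p.1.1 /\ A p.1.2) & p.2 = jj (code p.1.1 p.1.2)].
have GA x y t : G ((x, y), t) -> [/\ A x, A y & A t] by exact: gg_cl.
have HB x : fieldG H x <-> B x.
  split=> [[t [/GA[Ax _ _]|[Bx _ _ _]]]|[[t Gt]|imx]] //; first by left.
    by exists t; left.
  exists (jj (code x x)); right; split=> //=; [by right|by right|].
  by move=> [Ax _]; exact: imA imx Ax.
apply: (maxG H).
  split=> [p|HG]; first by left.
  have im0 : im (jj (e 0%N)) by exact: jj_im.
  have B0 : B (jj (e 0%N)) by right.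
  have [t Ht] := (HB _).2 B0.
  by have [/(imA _ im0)] := GA _ _ _ (HG _ Ht).
split.
- move=> [x y] t t' [Gt|[/= Bx By nA ->]] [Gt'|[/= Bx' By' nA' ->]] //.
  + exact: gg_fun gG _ _ _ Gt Gt'.
  + by case: nA'; have [] := GA _ _ _ Gt.
  + by case: nA; have [] := GA _ _ _ Gt'.
- move=> [x y] [x' y'] t [Gt|[/= Bx By nA E]] [Gt'|[/= Bx' By' nA' E']].
  + exact: gg_inj gG _ _ _ Gt Gt'.
  + have [_ _ At] := GA _ _ _ Gt; case: (imA t) => //; rewrite E'.
    by apply: jj_im; exact: codeA.
  + have [_ _ At] := GA _ _ _ Gt'; case: (imA t) => //; rewrite E.
    by apply: jj_im; exact: codeA.
  + have /code_inj[] // : code x y = code x' y'; last by move=> -> ->.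
    by apply: jj_inj; [exact: codeA|exact: codeA|rewrite -E].
- move=> x y /HB Bx /HB By; have [[Ax Ay]|nA] := pselect (A x /\ A y).
    by exists (s x y); left; exact: sG.
  by exists (jj (code x y)); right.
- move=> x y t [/GA[Ax Ay At]|[/= Bx By nA E]].
    by split; apply/HB; left.
  split; apply/HB => //; rewrite E; right; apply: jj_im; exact: codeA.
by move=> n; apply/HB; left.
Qed.

End Square.

Lemma infinite_square T : inj_le nat T -> inj_le (T * T) T.
Proof. by move=> [e /square_inj_le]. Qed.

Lemma infinite_seq T : inj_le nat T -> inj_le (seq T) T.
Proof.
move=> nT; have [s si] := infinite_square nT; have [e ei] := nT.
apply: (@inj_le_trans (T * T)); last exact: infinite_square.
pose c := foldr (fun x y => s (x, y)) (e 0%N).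
exists (fun l => (e (size l), c l)) => l l' [/ei].
by elim: l l' => [[]//|x l IH] [|y l'] //= [sz] /si [-> /(IH _ sz) ->].
Qed.

Fixpoint tower (T : Type) n : Type := if n is m.+1 then tower T m -> Prop else T.

(** Cantor's diagonal: g n differs at t from w n for every w that F sends to the
element t of the n-th summand; this applies to w = g itself. *)
Lemma koenig T (F : (forall n, tower T n.+1) -> {n & tower T n}) : ~ injective F.
Proof.
move=> Fi.
pose g n : tower T n.+1 := fun t => ~ exists w : forall n, tower T n.+1,
  F w = existT _ n t /\ w n t.
case E: (F g) => [n t].
have gE : g n t <-> ~ g n t.
  split=> [h h'|h]; first by apply: h; exists g.
  by move=> [w [wE wt]]; apply: h; have /Fi -> : F g = F w by rewrite E wE.
have ng : ~ g n t by move=> h; exact: (gE.1 h h).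
exact: ng (gE.2 ng).
Qed.

(** * Flatness and purity in equational form *)

(** Several relations are solved one row after the other. *)
Lemma eqflat_rows (R : nzRingType) (F : lmodType R) p m (A : 'M[R]_(p, m))
  (g : tup F m) : eqflat F -> A *v g = 0 ->
  exists k (L : 'M[R]_(m, k)) (y : tup F k), g = L *v y /\ A *m L = 0.
Proof.
move=> fF; elim: p A => [|p IH] A Ag.
  by exists m, 1%:M, g; rewrite mxact1 [A]flatmx0 mul0mx.
move: A Ag; rewrite -[p.+1]/(1 + p)%N => A; rewrite -[A]vsubmxK mxact_col => Ag.
have /catv_inj[Ag1 Ag2] : catv (usubmx A *v g) (dsubmx A *v g) = catv 0 0.
  by rewrite Ag; apply/ffunP => i; rewrite !ffunE; case: fintype.split => j; rewrite ffunE.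
have [k [L [y [gE AL]]]] := IH _ Ag2.
have [|k' [L' [y' [yE AL']]]] := fF _ (usubmx A *m L) y.
  by rewrite mxactA -gE.
exists k', (L *m L'), y'; rewrite mxactA -yE; split=> //.
by rewrite mul_col_mx !mulmxA AL' AL mul0mx col_mx0.
Qed.

Section EqFlatTheory.
Variable R : nzRingType.
Implicit Types M N : lmodType R.

Lemma vmap_comp (M N P : lmodType R) (f : {linear M -> N}) (g : {linear N -> P})
  (h : {linear M -> P}) m (x : tup M m) :
  (forall a, g (f a) = h a) -> vmap g (vmap f x) = vmap h x.
Proof. by move=> e; apply/ffunP => i; rewrite !ffunE. Qed.

Lemma vmap_id (M N : lmodType R) (f : {linear M -> N}) (g : {linear N -> M})
  m (x : tup M m) : (forall a, g (f a) = a) -> vmap g (vmap f x) = x.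
Proof. by move=> e; apply/ffunP => i; rewrite !ffunE. Qed.

Lemma eqflat_retract M N (i : {linear M -> N}) (p : {linear N -> M}) :
  (forall x, p (i x) = x) -> eqflat N -> eqflat M.
Proof.
move=> pi fN m r g rg.
have [|k [L [y [gy rL]]]] := fN m r (vmap i g).
  by rewrite -vmapM rg vmap0.
exists k, L, (vmap p y); split=> //.
by rewrite -vmapM -gy vmap_id.
Qed.

Lemma split_eqpure M N (i : {linear M -> N}) (p : {linear N -> M}) :
  (forall x, p (i x) = x) -> eqpure i.
Proof.
move=> pi m k A s h e; exists (vmap p h).
by rewrite -vmapM -e vmap_id.
Qed.

Lemma eqpure_comp M N (P : lmodType R) (f : {linear M -> N}) (g : {linear N -> P})
  (h : {linear M -> P}) : (forall a, g (f a) = h a) ->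
  eqpure f -> eqpure g -> eqpure h.
Proof.
move=> e pf pg m k A s x; rewrite -(vmap_comp _ e) => /pg[y] /pf[z] ->.
by exists z.
Qed.

Lemma eqflat_pure M N (f : {linear M -> N}) :
  injective f -> eqpure f -> eqflat N -> eqflat M.
Proof.
move=> fi pf fN m r g rg.
have [|k [L [y [gy rL]]]] := fN m r (vmap f g).
  by rewrite -vmapM rg vmap0.
by have [h hE] := pf _ _ _ _ _ gy; exists k, L, h.
Qed.

Lemma linear_pair M N : exists (i : {linear M -> (M * N)%type})
    (j : {linear N -> (M * N)%type}), (i =1 fun x => (x, 0)) /\ (j =1 fun y => (0, y)).
Proof.
have [i iE] : exists i : {linear M -> (M * N)%type}, i =1 fun x => (x, 0).
  by apply: linear_pack => a x y; apply: injective_projections; rewrite /= ?scaler0 ?addr0.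
have [j jE] : exists j : {linear N -> (M * N)%type}, j =1 fun y => (0, y).
  by apply: linear_pack => a x y; apply: injective_projections; rewrite /= ?scaler0 ?addr0.
by exists i, j.
Qed.

Lemma eqflat_prod M N : eqflat M -> eqflat N -> eqflat (M * N)%type.
Proof.
move=> fM fN m r g rg.
have [i [j [iE jE]]] := linear_pair M N.
pose fstL : {linear (M * N)%type -> M} := fst.
pose sndL : {linear (M * N)%type -> N} := snd.
have [|k [L [y [gy rL]]]] := fM m r (vmap fstL g).
  by rewrite -vmapM rg vmap0.
have [|k' [L' [y' [gy' rL']]]] := fN m r (vmap sndL g).
  by rewrite -vmapM rg vmap0.
exists (k + k')%N, (row_mx L L'), (catv (vmap i y) (vmap j y')); split.
  rewrite mxact_row -!vmapM -gy -gy'; apply/ffunP => l.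
  by rewrite !ffunE iE jE /=; case: (g l) => a b; congr (_, _); rewrite ?addr0 ?add0r.
by rewrite mul_mx_row rL rL' row_mx0.
Qed.

Lemma eqpure_image M N (f : {linear M -> N}) :
  eqpure f -> eqpure (val : {linear submod (lin_image f) -> N}).
Proof.
move=> pf m k A s h e.
have [t tE] : exists t, vmap f t = vmap (val : {linear submod (lin_image f) -> N}) s.
  by apply: vmap_lift => i; rewrite ffunE; have /asboolP := submod_valP (s i).
have [t' t'E] := pf _ _ _ _ _ (etrans tE e).
have fP x : f x \in lin_image f by apply/asboolP; exists x.
exists [ffun i => Submod (fP (t' i))]; apply/(@vmap_inj _ _ _ (val : {linear _ -> _})).
  exact: val_inj.
rewrite vmapM -tE t'E vmapM; congr (_ *v _).
by apply/ffunP => i; rewrite !ffunE.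
Qed.

Lemma image_eqpure M N (f : {linear M -> N}) : injective f ->
  eqpure (val : {linear submod (lin_image f) -> N}) -> eqpure f.
Proof.
move=> fi pf m k A s h e.
have fP x : f x \in lin_image f by apply/asboolP; exists x.
have [|t tE] := pf m k A [ffun i => Submod (fP (s i))] h.
  by rewrite -e; apply/ffunP => i; rewrite !ffunE.
have [t' t'E] : exists t', vmap f t' = vmap (val : {linear submod (lin_image f) -> N}) t.
  by apply: vmap_lift => i; rewrite ffunE; have /asboolP := submod_valP (t i).
exists t'; apply: (vmap_inj fi); rewrite vmapM t'E -vmapM -tE.
by apply/ffunP => i; rewrite !ffunE.
Qed.

(** A relation r g = 0 in M / S lifts to r g' in S; by purity r g' = r h with h in
S, and g' - h satisfies a relation in M. *)
Lemma eqflat_quot M (S : submodClosed M) :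
  eqflat M -> eqpure (val : {linear submod S -> M}) -> eqflat (lquot S).
Proof.
move=> fM pS m r g rg.
have [g' g'E] := vmap_lift (f := lpi S) (fun i => lpi_surj (g i)).
have rS : (r *v g') 0 \in S.
  apply/lpi_eq0; have := congr1 (fun h : tup _ 1 => h 0) rg.
  by rewrite -g'E -vmapM [LHS]ffunE [RHS]ffunE.
have [|h hE] := pS 1%N m r [ffun=> Submod rS] g'.
  by apply/ffunP => i; rewrite !ffunE /= [i]ord1 !ffunE.
pose v := vmap (val : {linear submod S -> M}) h.
have [|k [L [y [gy rL]]]] := fM m r (g' - v).
  rewrite mxactBr /v -vmapM -hE; apply/ffunP => i.
  by rewrite !ffunE /= [i]ord1 !ffunE subrr.
exists k, L, (vmap (lpi S) y); split=> //.
rewrite -vmapM -gy vmapB g'E; apply/ffunP => i; rewrite tupB.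
rewrite [X in _ - X](_ : _ = 0) ?subr0 // ffunE.
by apply/lpi_eq0; rewrite ffunE /=; exact: submod_valP.
Qed.

Lemma aec_leP M (S : submodClosed M) : aec_le (flat_pure R) S <->
  eqflat M /\ eqpure (val : {linear submod S -> M}).
Proof.
split=> [[/= /flatP fM _ /pure_eqpure pS]|[fM pS]]; first by [].
split; rewrite /=; first exact/flatP.
  by apply/flatP/(eqflat_pure _ pS) => //; exact: val_inj.
exact: eqpure_pure.
Qed.

Lemma aec_embeddingP M N (f : {linear M -> N}) :
  aec_embedding (flat_pure R) f <-> [/\ injective f, eqflat N & eqpure f].
Proof.
split=> [[_ fi /aec_leP[fN /(image_eqpure fi) pf]]|[fi fN pf]]; first by [].
split=> //=; first by apply/flatP/(eqflat_pure fi).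
by apply/aec_leP; split=> //; exact: eqpure_image.
Qed.

End EqFlatTheory.

(** * Splitting over a left perfect ring *)

Section Perfect.
Variable R : nzRingType.
Hypothesis perf : left_perfect R.
Implicit Types M N : lmodType R.

(** The kernel K of p is flat, because N is flat: a relation in K solved in M by
g = L y gives L (p y) = 0, so that y can be corrected modulo the columns
annihilated by L to lie in K.  Hence the extension of N by K splits. *)
Lemma perfect_section M N (p : {linear M -> N}) : eqflat M -> eqflat N ->
  (forall y, exists x, p x = y) -> exists s : {linear N -> M}, forall y, p (s y) = y.
Proof.
move=> fM fN ps.
have Ks : psub (fun x => p x = 0).
  by split=> [|a x y x0 y0]; rewrite ?raddf0 // linearP /= x0 y0 scaler0 addr0.
pose K : submodClosed M := psub_pred Ks.
have KP x : x \in K <-> p x = 0 by exact: (psub_predE Ks).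
have fK : eqflat (submod K).
  move=> m r g rg.
  have [|k [L [y [gy rL]]]] := fM m r (vmap (val : {linear submod K -> M}) g).
    by rewrite -vmapM rg vmap0.
  have [|k' [Q [z [yz LQ]]]] := eqflat_rows (A := L) (g := vmap p y) fN.
    rewrite -vmapM -gy; apply/ffunP => i; rewrite !ffunE.
    by apply/(KP _)/submod_valP.
  have [w wE] := vmap_lift (f := p) (fun i => ps (z i)).
  have yK i : (y - Q *v w) i \in K.
    apply/KP; rewrite tupB raddfB /=.
    have -> : p (y i) = (vmap p y) i by rewrite [RHS]ffunE.
    have -> : p ((Q *v w) i) = (vmap p (Q *v w)) i by rewrite [RHS]ffunE.
    by rewrite vmapM wE yz subrr.
  exists k, L, [ffun i => Submod (yK i)]; split=> //.
  apply: (@vmap_inj _ _ _ (val : {linear submod K -> M})); first exact: val_inj.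
  rewrite gy vmapM -[LHS]subr0 -(mxact0l m w) -LQ mxactA -mxactBr.
  congr (_ *v _); apply/ffunP => i.
  rewrite [RHS]ffunE.
  by have -> : [ffun i => Submod (yK i)] i = Submod (yK i) by rewrite ffunE.
have ex x : p x = 0 <-> exists c : submod K, val c = x.
  split=> [/KP xK|[c <-]]; first by exists (Submod xK).
  by apply/KP/submod_valP.
pose E := @Extension R N (submod K) M (val : {linear submod K -> M}) p val_inj ps ex.
have [h [hK hp]] := perf ((flatP _).2 fK) ((flatP _).2 fN) E.
pose u x : M := x - val (h x).1.
have pu x : p (u x) = p x.
  rewrite /u raddfB /= [X in _ - X](_ : _ = 0) ?subr0 //; exact/KP/submod_valP.
have uK x y : p x = p y -> u x = u y.
  move=> pxy; have /KP xyK : p (x - y) = 0 by rewrite raddfB /= pxy subrr.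
  have e : val (h x).1 - val (h y).1 = x - y.
    have := congr1 (fun q => val q.1) (hK (Submod xyK)).
    by rewrite [h _](raddfB h).
  apply/eqP; rewrite /u subr_eq -addrA [X in _ + X]addrC e.
  by rewrite addrC subrK.
have /choice[c cE] := ps.
have [s sE] : exists s : {linear N -> M}, s =1 u \o c.
  apply: linear_pack => a x y /=.
  have -> : u (c (a *: x + y)) = u (a *: c x + c y).
    by apply: uK; rewrite linearP !cE.
  rewrite /u; have -> : val (h (a *: c x + c y)).1 =
      a *: val (h (c x)).1 + val (h (c y)).1 by rewrite linearP.
  by rewrite scalerBr opprD addrACA.
by exists s => y; rewrite sE /= pu cE.
Qed.

Lemma perfect_retraction M N (f : {linear M -> N}) : injective f -> eqpure f ->
  eqflat N -> exists p : {linear N -> M}, forall x, p (f x) = x.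
Proof.
move=> fi pf fN.
pose S := lin_image f.
have fQ : eqflat (lquot S) by apply: eqflat_quot => //; exact: eqpure_image.
have [s sE] := perfect_section (p := lpi S) fN fQ (@lpi_surj _ _ S).
have /choice[c cE] : forall x, exists c, f c = x - s (lpi S x).
  by move=> x; have /asboolP : x - s (lpi S x) \in S by apply/lpi_eq; rewrite sE.
have [p pE] : exists p : {linear N -> M}, p =1 c.
  apply: linear_pack => a x y; apply: fi; rewrite linearP !cE linearP linearP.
  by rewrite scalerBr opprD addrACA.
exists p => x; rewrite pE; apply: fi; rewrite cE.
have -> : lpi S (f x) = 0 by apply/lpi_eq0/asboolP; exists x.
by rewrite raddf0 subr0.
Qed.

End Perfect.

(** * Free modules *)

Section Free.
Variables (R : nzRingType) (T : choiceType).
Notation fr := {freeg T / R}.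

Lemma fr_sum (z : fr) : z = \sum_(x <- dom z) coeff x z *: << x >>.
Proof.
rewrite -{1}[z]freeg_sumE; apply: eq_bigr => x _; apply/eqP/freeg_eqP => y.
by rewrite coeffZ !coeffU mul1r.
Qed.

Lemma fr_lift (M : lmodType R) (f : T -> M) :
  exists g : {linear fr -> M}, forall x, g << x >> = f x.
Proof.
have [g gE] : exists g : {linear fr -> M}, g =1 fglift f.
  apply: linear_pack => a x y.
  have fB := lift_is_additive f.
  have f0 : fglift f 0 = 0 by have := fB 0 0; rewrite !subrr.
  have fD : {morph fglift f : u v / u + v}.
    by move=> u v; rewrite -{1}[v]opprK fB -(sub0r v) fB f0 sub0r opprK.
  rewrite fD; congr (_ + _); rewrite -[x]freeg_sumE scaler_sumr.
  rewrite !(big_morph _ fD f0) scaler_sumr; apply: eq_bigr => z _.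
  have -> : a *: << coeff z x *g z >> = << a * coeff z x *g z >>.
    by apply/eqP/freeg_eqP => w; rewrite coeffZ !coeffU mulrA.
  by rewrite !liftU scalerA.
by exists g => x; rewrite gE liftU scale1r.
Qed.

Lemma fr_ext (M : lmodType R) (f g : {linear fr -> M}) :
  (forall x, f << x >> = g << x >>) -> f =1 g.
Proof.
move=> fg z; rewrite [z]fr_sum !linear_sum; apply: eq_bigr => x _.
by rewrite !linearZ fg.
Qed.

Lemma eqflat_fr : eqflat fr.
Proof.
move=> m r g rg; pose d := undup (flatten [seq dom (g i) | i <- enum 'I_m]).
pose L : 'M[R]_(m, size d) := \matrix_(i, j) coeff (tnth (in_tuple d) j) (g i).
exists (size d), L, [ffun j => << tnth (in_tuple d) j >>]; split.
  apply/ffunP => i; rewrite ffunE [LHS]fr_sum.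
  under [RHS]eq_bigr do rewrite mxE ffunE.
  rewrite -(big_tuple _ _ (in_tuple d) xpredT (fun x => coeff x (g i) *: << x >>)) /=.
  have -> : \sum_(x <- d) coeff x (g i) *: << x >> =
      \sum_(x <- d | x \in dom (g i)) coeff x (g i) *: (<< x >> : fr).
    rewrite (bigID (fun x => x \in dom (g i))) /= [X in _ + X]big1 ?addr0 // => x.
    by move=> /coeff_outdom ->; rewrite scale0r.
  rewrite -[RHS]big_filter; apply: perm_big; apply: uniq_perm.
  - exact: uniq_dom.
  - by rewrite filter_uniq // undup_uniq.
  move=> x; rewrite mem_filter mem_undup; case: (boolP (x \in dom _)) => //= xi.
  symmetry; apply/flattenP; exists (dom (g i)) => //.
  by apply: map_f; rewrite mem_enum.
apply/rowP => j; rewrite !mxE.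
have := congr1 (fun h : tup fr 1 => coeff (tnth (in_tuple d) j) (h 0)) rg.
rewrite !ffunE coeff0 => e; rewrite -[RHS]e raddf_sum; apply: eq_bigr => i _.
by rewrite mxE /= coeffZ.
Qed.

Lemma inj_le_fr lam : inj_le nat lam -> inj_le R lam -> inj_le T lam -> inj_le fr lam.
Proof.
move=> natl Rl Tl; apply: (@inj_le_trans (seq (R * T))).
  exists (fun z => fgenum z) => x y e.
  by rewrite -[x]Freeg_enum e Freeg_enum.
apply: inj_le_trans (infinite_seq natl); apply: inj_le_seq.
apply: inj_le_trans (infinite_square natl); exact: inj_le_prod.
Qed.

Lemma fr_basis_inj : injective (fun x => << x >> : fr).
Proof.
move=> x y /(congr1 (coeff y)); rewrite !coeffU eqxx.
by case: eqP => // _ /eqP; rewrite mulr0 mulr1 eq_sym oner_eq0.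
Qed.

End Free.

(** * Solving a sequence of equations in a pure extension *)

Section Colim.
Variables (R : nzRingType) (P : lmodType R) (t : nat -> {linear P -> P}).

Fixpoint transition n k : {linear P -> P} :=
  if k is k'.+1 then (transition n.+1 k' \o t n : {linear P -> P}) else idfun.

Lemma transition_kill n k l x : transition n k x = 0 -> transition n (k + l) x = 0.
Proof.
elim: k n x => [|k IH] n x /=; first by move=> ->; rewrite raddf0.
exact: IH.
Qed.

(** The colimit of the maps t_n is realised inside the quotient of the sequences
by those that vanish eventually. *)
Lemma sequential_colimit : exists (C : lmodType R) (io : nat -> {linear P -> C}),
  [/\ forall n x, io n.+1 (t n x) = io n x,
      forall c, exists n x, io n x = c &
      forall n x, io n x = 0 -> exists k, transition n k x = 0].
Proof.
pose Z (w : nat -> P) := exists n0, forall n, (n0 <= n)%N -> w n = 0.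
have Zs : psub Z.
  split=> [|a x y [n nx] [k ky]]; first by exists 0%N.
  exists (n + k)%N => l nkl.
  rewrite /GRing.add /= /GRing.scale /= nx ?ky ?scaler0 ?addr0 //.
    exact: leq_trans (leq_addl _ _) nkl.
  exact: leq_trans (leq_addr _ _) nkl.
pose S : submodClosed (nat -> P) := psub_pred Zs.
pose u n x : nat -> P := fun m => if (m < n)%N then 0 else transition n (m - n) x.
have /choice[i0 i0E] : forall n, exists f : {linear P -> lquot S},
    forall x, f x = lpi S (u n x).
  move=> n; apply: linear_pack => a x y.
  rewrite -linearP; congr (lpi _ _); apply/funext => m; rewrite /u.
  rewrite /GRing.add /= /GRing.scale /=; case: ifP => _; last exact: linearP.
  by rewrite scaler0 addr0.
have i0S n x : i0 n.+1 (t n x) = i0 n x.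
  rewrite !i0E; apply/lpi_eq/(psub_predE Zs); exists n.+1 => m nm.
  apply/eqP; rewrite subr_eq0; apply/eqP.
  have -> : u n x m = transition n (m - n) x by rewrite /u ltnNge (ltnW nm).
  have -> : u n.+1 (t n x) m = transition n.+1 (m - n.+1) (t n x).
    by rewrite /u ltnNge nm.
  by rewrite -(subnSK nm).
have i0up n k x : exists y, i0 n x = i0 (k + n)%N y.
  elim: k => [|k [y ->]]; first by exists x.
  by exists (t (k + n)%N y); rewrite addSn i0S.
pose D q := exists n x, i0 n x = q.
have Ds : psub D.
  split=> [|a _ _ [n [x <-]] [k [y <-]]]; first by exists 0%N, 0; rewrite raddf0.
  have [x' ->] := i0up n k x; have [y' ->] := i0up k n y.
  by exists (k + n)%N, (a *: x' + y'); rewrite linearP [(n + k)%N]addnC.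
pose C := submod (psub_pred Ds).
have iD n x : i0 n x \in psub_pred Ds by apply/psub_predE; exists n, x.
have /choice[io ioE] : forall n, exists f : {linear P -> C},
    forall x, f x = Submod (iD n x).
  move=> n; apply: linear_pack => a x y; apply: val_inj; rewrite /= linearP.
  by [].
exists C, io; split=> [n x|c|n x].
- by rewrite !ioE; apply: val_inj => /=.
- have /(psub_predE Ds)[n [x nx]] := submod_valP c.
  by exists n, x; rewrite ioE; apply: val_inj.
move=> /(congr1 val); rewrite ioE /= i0E => /lpi_eq0 /(psub_predE Zs)[n0 h].
exists n0; have := h (n0 + n)%N (leq_addr _ _).
by rewrite /u ltnNge leq_addl /= addnK.
Qed.

End Colim.

Section Extension.
Variables (R : nzRingType) (B : lmodType R).
Variables (k : nat -> nat) (L : forall n, 'M[R]_(k n, k n.+1)).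
Variable x : forall n, tup B (k n).

(** The extension is the colimit of B + R^(k n) along
(b, w) |-> (b + w x_n, w L_n), and y_n is the class of the basis of R^(k n).  To
keep a single module along the system, R^(k n) is replaced by a free module of
countable rank, on which the superfluous basis elements are sent to 0. *)
Lemma solving_extension : eqflat B ->
  exists (N : lmodType R) (j : {linear B -> N}) (y : forall n, tup N (k n)),
  [/\ injective j, eqflat N, eqpure j,
      forall n, y n = vmap j (x n) + L n *v y n.+1 &
      forall lam : Type, inj_le nat lam -> inj_le R lam -> inj_le B lam -> inj_le N lam].
Proof.
move=> fB; pose W : lmodType R := {freeg nat / R}; pose P : lmodType R := (B * W)%type.
have fP : eqflat P by apply: eqflat_prod => //; exact: eqflat_fr.
have /choice[phi phiE] : forall n, exists f : {linear W -> B},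
    forall i, f << i >> = if insub i is Some i' then x n i' else 0.
  by move=> n; apply: (fr_lift (fun i => if insub i is Some i' then x n i' else 0)).
have /choice[psi psiE] : forall n, exists f : {linear W -> W},
    forall i, f << i >> = if insub i is Some i'
      then \sum_j L n i' j *: << (j : nat) >> else 0.
  by move=> n; apply: (fr_lift (fun i => if insub i is Some i'
      then \sum_j L n i' j *: (<< (j : nat) >> : W) else 0)).
have /choice[t tE] : forall n, exists f : {linear P -> P},
    forall p, f p = (p.1 + phi n p.2, psi n p.2).
  move=> n; apply: linear_pack => a u v; apply: injective_projections => /=.
    by rewrite linearP scalerDr addrACA.
  by rewrite linearP.
have [C [io [ioS ioT io0]]] := sequential_colimit t.
have ioup n l p : exists q, io n p = io (l + n)%N q.
  elim: l => [|l [q ->]]; first by exists p.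
  by exists (t (l + n)%N q); rewrite addSn ioS.
have iotup m (g : tup C m) : exists n h, g = vmap (io n) h.
  elim: m g => [|m IH] g; first by exists 0%N, 0; apply/ffunP => -[].
  have [n [h hE]] := IH [ffun i => g (fintype.lift ord0 i)].
  have [n' [p pE]] := ioT (g ord0).
  have [p' p'E] := ioup n' n p.
  have /choice[h' h'E] : forall i, exists q, io n (h i) = io (n + n')%N q.
    by move=> i; rewrite addnC; exact: ioup.
  exists (n + n')%N, [ffun i => if unlift ord0 i is Some i' then h' i' else p'].
  apply/ffunP => i; rewrite !ffunE; case: unliftP => [i' ->|->].
    rewrite -h'E; have := congr1 (fun u : tup C m => u i') hE.
    by rewrite !ffunE.
  by rewrite -p'E.
have io0tup n m (h : tup P m) : vmap (io n) h = 0 ->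
    exists l, vmap (transition t n l) h = 0.
  move=> h0; have /choice[l lE] : forall i, exists l, transition t n l (h i) = 0.
    move=> i; apply: io0; have := congr1 (fun u : tup C m => u i) h0.
    by rewrite !ffunE.
  exists (\max_i l i)%N; apply/ffunP => i; rewrite !ffunE.
  rewrite -(@subnKC (l i) (\max_i l i)%N) ?leq_bigmax //.
  exact: transition_kill.
have [i1 [i2 [i1E i2E]]] := linear_pair B W.
have t1 n b : t n (i1 b) = i1 b.
  by rewrite tE i1E /= !raddf0 addr0.
have trans1 n l b : transition t n l (i1 b) = i1 b.
  by elim: l n => [|l IH] n //=; rewrite t1.
have io1 n b : io n (i1 b) = io 0%N (i1 b).
  by elim: n => [|n <-] //; rewrite -{1}(t1 n b) ioS.
pose j : {linear B -> C} := io 0%N \o i1.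
pose y n : tup C (k n) := [ffun i => io n (i2 << nat_of_ord i >>)].
pose fstL : {linear P -> B} := fst.
exists C, j, y; split.
- move=> b b' /eqP; rewrite -subr_eq0 -raddfB => /eqP /io0 [l].
  by rewrite trans1 i1E => -[] /eqP; rewrite subr_eq0 => /eqP.
- move=> m r g rg; have [n [h hE]] := iotup _ g.
  have [l] : exists l, vmap (transition t n l) (r *v h) = 0.
    by apply: io0tup; rewrite vmapM -hE.
  rewrite vmapM => /fP [k' [Q [z [hz rQ]]]].
  have ioQ l' n' p : io n' p = io (l' + n')%N (transition t n' l' p).
    by elim: l' n' p => [|l' IH] n' p //=; rewrite addSnnS -IH ioS.
  exists k', Q, (vmap (io (l + n)%N) z); split=> //.
  rewrite -vmapM -hz hE; apply/ffunP => i; rewrite !ffunE; exact: ioQ.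
- move=> m k' A s h e; have [n [h' h'E]] := iotup _ h.
  have [l] : exists l, vmap (transition t n l) (vmap i1 s - A *v h') = 0.
    apply: io0tup; rewrite vmapB vmapM -h'E -e; apply/ffunP => i.
    by rewrite !ffunE /= io1 subrr.
  rewrite vmapB vmapM => /eqP; rewrite subr_eq0 => /eqP E.
  exists (vmap fstL (vmap (transition t n l) h')); rewrite -vmapM -E.
  by apply/ffunP => i; rewrite !ffunE trans1 i1E.
- move=> n; apply/ffunP => i; rewrite !ffunE -ioS.
  have -> : t n (i2 << nat_of_ord i >>) =
     i1 (x n i) + \sum_l L n i l *: i2 << (l : nat) >>.
    rewrite tE i1E i2E /= phiE psiE valK add0r.
    under eq_bigr do rewrite -linearZ.
    rewrite -linear_sum i2E.
    by apply: injective_projections; rewrite /= ?addr0 ?add0r.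
  rewrite raddfD /= io1; congr (_ + _); rewrite linear_sum.
  by apply: eq_bigr => l _; rewrite linearZ ffunE.
move=> lam natl Rl Bl.
apply: (@inj_le_trans (nat * P)%type).
  apply: (@inj_le_surj _ _ (fun q : nat * P => io q.1 q.2)) => c.
  by have [n [p <-]] := ioT c; exists (n, p).
have sq := infinite_square natl.
apply: inj_le_trans sq; apply: inj_le_prod => //.
apply: inj_le_trans (infinite_square natl); apply: inj_le_prod => //.
exact: inj_le_fr.
Qed.

End Extension.

(** * Superstability implies the chain condition *)

Section Chain.
Variable R : nzRingType.

Section Step.
Variables (m : nat) (Q : forall k, 'M[R]_(m, k) -> Prop).
Hypothesis step : forall k (M : 'M_(m, k)), Q M ->
  exists t : {l & 'M[R]_(k, l)}, Q (M *m tagged t) /\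
    forall N, M <> M *m tagged t *m N.

Record dstate := DState { dk : nat; dM : 'M[R]_(m, dk); dQ : Q dM }.

Definition dL (s : dstate) := projT1 (cid (step (dQ s))).
Definition dnext (s : dstate) := DState (projT2 (cid (step (dQ s)))).1.

(** Dependent choice; the states carry the number of columns, so that the
dimensions of consecutive matrices match by computation. *)
Lemma chain_of_step k (M : 'M_(m, k)) : Q M ->
  exists (k : nat -> nat) (M : forall n, 'M[R]_(m, k n))
    (L : forall n, 'M[R]_(k n, k n.+1)),
    forall n, M n.+1 = M n *m L n /\ forall N, M n <> M n.+1 *m N.
Proof.
move=> QM; pose s n := iter n dnext (DState QM).
exists (fun n => dk (s n)), (fun n => dM (s n)), (fun n => tagged (dL (s n))).
by move=> n; split=> //; exact: (projT2 (cid (step (dQ (s n))))).2.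
Qed.

End Step.

Lemma not_dcc_chain : ~ mx_dcc R ->
  exists m (k : nat -> nat) (M : forall n, 'M[R]_(m, k n))
    (L : forall n, 'M[R]_(k n, k n.+1)),
    forall n, M n.+1 = M n *m L n /\ forall N, M n <> M n.+1 *m N.
Proof.
move=> ndcc; apply: contrapT => nch; apply: ndcc => m Q [k0 [M0 QM0]].
apply: contrapT => nex; apply: nch; exists m.
apply: (@chain_of_step m Q _ k0 M0 QM0) => k M QM.
apply: contrapT => nt; apply: nex; exists k, M; split=> // l L QL.
apply: contrapT => nN; apply: nt; exists (existT _ l L); split=> // N e.
by apply: nN; exists N.
Qed.

(** Universality is restated for maps, because two consecutive universal extensions
of a chain meet in modules that are isomorphic but not equal ([trace_iso]). *)
Definition universal_map (lam : Type) (A U : lmodType R) (i : {linear A -> U}) :=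
  forall (N : lmodType R) (g : {linear A -> N}), injective g -> eqflat N ->
    eqpure g -> inj_le N lam ->
    exists f : {linear N -> U}, [/\ injective f, eqpure f & forall a, f (g a) = i a].

Lemma universal_over_map (lam : choiceType) (M : lmodType R) (N : submodClosed M) :
  universal_over (flat_pure R) lam N ->
  [/\ universal_map lam (val : {linear submod N -> M}), eqflat M,
      eqpure (val : {linear submod N -> M}) & inj_le M lam].
Proof.
move=> [/aec_leP[fM pN] /card_eq_inj_le Ml _ h]; split=> // N' g gi fN' pg N'l.
have [|f [/aec_embeddingP[fi _ pf] fg]] := h N' g _ (introT (card_leTP _ _) N'l).
  by apply/aec_embeddingP.
by exists f.
Qed.

(** Identifies the submodule S of M with its copy inside T, in which the conditions
on chains are expressed. *)
Lemma trace_iso (M : lmodType R) (T S : submodClosed M) :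
  {subset S <= T} -> exists (f : {linear submod S -> submod (trace T S)})
    (g : {linear submod (trace T S) -> submod S}),
    [/\ cancel f g, cancel g f, forall x, val (val (f x)) = val x &
        forall y, val (g y) = val (val y)].
Proof.
move=> ST.
have inT (x : submod S) : val x \in T by apply: ST; exact: submod_valP.
have inTr (x : submod S) : Submod (inT x) \in trace T S by exact: submod_valP.
have inS (y : submod (trace T S)) : val (val y) \in S by exact: submod_valP y.
have [f fE] : exists f : {linear submod S -> submod (trace T S)},
    f =1 fun x => Submod (inTr x).
  by apply: linear_pack => a x y; do 2!apply: val_inj.
have [g gE] : exists g : {linear submod (trace T S) -> submod S},
    g =1 fun y => Submod (inS y).
  by apply: linear_pack => a x y; apply: val_inj.
exists f, g; split.
- by move=> x; rewrite gE; apply: val_inj; rewrite /= fE.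
- by move=> y; rewrite fE; do 2!apply: val_inj; rewrite /= gE.
- by move=> x; rewrite fE.
by move=> y; rewrite gE.
Qed.

Section Index.
Variables (I : choiceType) (le : rel I).
Hypothesis lim : limit_order le.

Lemma succ_exists i : exists j, is_succ le i j.
Proof.
case: lim => wo _ /(_ i)[j0 ij0].
have [|j [[ij jmin] _]] := wo (mem [pred j | slt le i j]).
  by exists j0.
by exists j; split=> // k ik; apply: jmin.
Qed.

Lemma slt_le i j : slt le i j -> le i j.
Proof. by case/andP. Qed.
End Index.

Lemma limit_model_two_steps (lam : choiceType) (M : lmodType R) :
  limit_model (flat_pure R) lam M ->
  exists (A B C : lmodType R) (i : {linear A -> B}) (j : {linear B -> C}),
  [/\ universal_map lam i, universal_map lam j, eqpure j &
      [/\ eqflat A, eqflat B, inj_le A lam, inj_le B lam & inj_le C lam]].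
Proof.
move=> [I [le [N [[lim _] hN le_sub _ [_ hS]]]]].
have [_ [i0] _] := lim.
have [i1 s01] := succ_exists lim i0; have [i2 s12] := succ_exists lim i1.
have [u01 f1 p01 c1] := universal_over_map (hS _ _ s01).
have [u12 f2 p12 c2] := universal_over_map (hS _ _ s12).
have [sub01 _] := le_sub _ _ (slt_le (proj1 s01)).
have [sub12 _] := le_sub _ _ (slt_le (proj1 s12)).
have [th [ph [thK phK thE phE]]] := trace_iso sub12.
exists (submod (trace (N i1) (N i0))), (submod (N i1)), (submod (N i2)).
exists val, (val \o th); split=> //.
- move=> N' g gi fN' pg N'l.
  have gph_inj : injective (g \o ph) by apply: inj_comp => //; exact: can_inj phK.
  have gph_pure : eqpure (g \o ph).
    by apply: (eqpure_comp (f := ph) (g := g)) => //; exact: split_eqpure phK.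
  have [f [fi pf fg]] := u12 N' _ gph_inj fN' gph_pure N'l.
  exists f; split=> // b; by have := fg (th b); rewrite /= thK.
- by apply: (eqpure_comp (f := th)) p12 => //; exact: split_eqpure thK.
split=> //.
  by apply: eqflat_pure p01 f1; exact: val_inj.
by apply: inj_le_trans c1; exists val; exact: val_inj.
Qed.

End Chain.

Section Counting.
Variables (R : nzRingType) (mu : choiceType).

Definition koenig_type : choiceType := {classic {n & tower mu n}}.

Lemma inj_le_koenig : inj_le mu koenig_type.
Proof.
pose p (s : {n & tower mu n}) : option mu :=
  match s with existT 0%N t => Some t | existT _.+1 _ => None end.
exists (fun t => existT (tower mu) 0%N t : koenig_type) => x y /(congr1 p).
by case.
Qed.

Lemma inj_le_tup (T lam : Type) k : inj_le nat lam -> inj_le T lam -> inj_le {ffun 'I_k -> T} lam.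
Proof.
move=> natl Tl; apply: inj_le_trans (infinite_seq natl).
apply: (@inj_le_trans (seq T)); last exact: inj_le_seq.
exists (fun h : {ffun 'I_k -> T} => [seq h i | i <- enum 'I_k]) => g h e.
apply/ffunP => i; have := eq_in_map g h (enum 'I_k).
by case=> _ /(_ e) /(_ i); rewrite mem_enum => ->.
Qed.

(** The counting argument: the solutions y_0 attached to the points of the product
of the sets tower mu n.+1 lie in C^(k 0), which is too small to separate
them. *)
Lemma universal_map_no_chain (A B C : lmodType R) (i : {linear A -> B})
    (j : {linear B -> C}) m (k : nat -> nat) (M : forall n, 'M[R]_(m, k n))
    (L : forall n, 'M[R]_(k n, k n.+1)) :
  let lam : Type := koenig_type in
  universal_map lam i -> universal_map lam j -> eqpure j -> eqflat A -> eqflat B ->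
  inj_le nat lam -> inj_le R lam -> inj_le A lam -> inj_le B lam -> inj_le C lam ->
  (forall n, M n.+1 = M n *m L n) -> exists n N, M n = M n.+1 *m N.
Proof.
move=> lam ui uj pj fA fB natl Rl Al Bl Cl ML.
pose T : choiceType := (koenig_type * nat)%type.
pose W : lmodType R := {freeg T / R}.
have Tl : inj_le T lam.
  apply: inj_le_trans (infinite_square natl); apply: inj_le_prod => //; exact: inj_le_refl.
have [g0 [g1 [g0E g1E]]] := linear_pair A W.
(* A + W embeds in B over A, so B contains a pure free module of rank lam. *)
have [f0 [f0i f0p _]] : exists f : {linear (A * W)%type -> B},
    [/\ injective f, eqpure f & forall a, f (g0 a) = i a].
  apply: ui.
  - by move=> a b; rewrite !g0E => -[].
  - by apply: eqflat_prod => //; exact: eqflat_fr.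
  - by apply: (split_eqpure (p := (fst : {linear (A * W)%type -> A}))) => a; rewrite g0E.
  apply: inj_le_trans (infinite_square natl); apply: inj_le_prod => //.
  exact: inj_le_fr.
pose e : {linear W -> B} := f0 \o g1.
pose je : {linear W -> C} := j \o e.
have pe : eqpure e.
  apply: (eqpure_comp (f := g1) (g := f0)) => //.
  by apply: (split_eqpure (p := (snd : {linear (A * W)%type -> W}))) => a; rewrite g1E.
have pje : eqpure je by apply: (eqpure_comp (f := e) (g := j)).
pose Pi := forall n, tower mu n.+1.
pose pt (xi : Pi) n : koenig_type := existT (tower mu) n.+1 (xi n).
pose b xi n : tup W (k n) := [ffun i => << (pt xi n, nat_of_ord i) >>].
have /choice[Y YE] : forall xi : Pi, exists Y : forall n, tup C (k n),
    forall n, Y n = vmap je (b xi n) + L n *v Y n.+1.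
  move=> xi.
  have [N [jN [y [jNi fN pN yE Nl]]]] := solving_extension L (fun n => vmap e (b xi n)) fB.
  have [f [_ _ fj]] := uj N jN jNi fN pN (Nl _ natl Rl Bl).
  exists (fun n => vmap f (y n)) => n.
  rewrite {1}yE vmapD -vmapM; congr (_ + _).
  by apply/ffunP => l; rewrite !ffunE /= fj.
have [c ci] := inj_le_tup (k 0%N) natl Cl.
have [xi [eta [xieta YY]]] : exists xi eta : Pi, xi <> eta /\ Y xi 0%N = Y eta 0%N.
  apply: contrapT => nY; apply: (@koenig mu (fun xi => c (Y xi 0%N))).
  move=> xi eta /ci Yxe; apply: contrapT => ne; apply: nY.
  by exists xi, eta.
have exn : exists n, `[< xi n <> eta n >].
  apply: contrapT => h; apply: xieta; apply: functional_extensionality_dep => n.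
  by apply: contrapT => ne; apply: h; exists n; apply/asboolP.
case: (ex_minnP exn) => n /asboolP ne minn.
have MY l : (l <= n)%N -> M l *v Y xi l = M l *v Y eta l.
  elim: l => [_|l IH ln]; first by rewrite YY.
  have El zeta : M l.+1 *v Y zeta l.+1 = M l *v Y zeta l - M l *v vmap je (b zeta l).
    by rewrite ML mxactA (YE zeta l) mxactDr addrC addKr.
  have bE : b xi l = b eta l.
    have e_l : xi l = eta l.
      apply: contrapT => /asboolP /minn; by rewrite leqNgt ln.
    by apply/ffunP => p; rewrite !ffunE /pt e_l.
  by rewrite !El IH 1?ltnW // bE.
(* M n y_n is the same for xi and eta; the equation at n isolates the difference
   of the two values of x_n. *)
have key : vmap je (M n *v (b xi n - b eta n)) = M n.+1 *v (Y eta n.+1 - Y xi n.+1).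
  rewrite vmapM vmapB mxactBr ML mxactBr !mxactA.
  have := MY n (leqnn n); rewrite (YE xi n) (YE eta n) !mxactDr => E.
  by apply/eqP; rewrite subr_eq addrAC eq_sym subr_eq E addrC.
have [h hE] := pje _ _ _ _ _ key.
have pt_ne : pt xi n != pt eta n.
  apply/eqP => E; apply: ne.
  by have := projT2_eq E; rewrite (eq_irrelevance (projT1_eq E) erefl).
exists n, (\matrix_(l, p) coeff (pt xi n, nat_of_ord p) (h l)).
have cM t q (D : 'M[R]_(m, q)) (g : tup W q) r :
    coeff t ((D *v g) r) = \sum_l D r l * coeff t (g l).
  by rewrite ffunE raddf_sum; apply: eq_bigr => l _; rewrite /= coeffZ.
apply/matrixP => r p; rewrite mxE.
under eq_bigr do rewrite mxE; rewrite -cM -hE cM (bigD1 p) //= big1 => [|l lp].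
  by rewrite addr0 tupB coeffB !ffunE !coeffU !xpair_eqE !eqxx
     (negPf (_ : pt eta n != pt xi n)) 1?eq_sym // !mul1r subr0 mulr1.
rewrite tupB coeffB !ffunE !coeffU !xpair_eqE eqxx /=.
have -> : (nat_of_ord l == p) = false by apply: negbTE; exact: lp.
by rewrite (negPf (_ : pt eta n != pt xi n)) 1?eq_sym // subrr mulr0.
Qed.

End Counting.

Theorem superstable_left_perfect (R : nzRingType) :
  superstable (flat_pure R) -> left_perfect R.
Proof.
move=> [mu [/card_leTP Rmu ss]].
have mul := inj_le_koenig mu.
have Rl : inj_le R (koenig_type mu).
  apply: inj_le_trans mul; apply: inj_le_trans Rmu.
  by exists (fun r : R => inl r : R + nat)%type => x y [].
have natl : inj_le nat (koenig_type mu).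
  apply: inj_le_trans mul; apply: inj_le_trans Rmu.
  by exists (fun n : nat => inr n : R + nat)%type => x y [].
have [[M /limit_model_two_steps]] := ss (koenig_type mu) (introT (card_leTP _ _) mul).
move=> [A [B [C [i [j [ui uj pj [fA fB Al Bl Cl]]]]]]] _.
apply: dcc_left_perfect; apply: contrapT => /not_dcc_chain[m [k [D [L DL]]]].
have [|n [N nN]] :=
    universal_map_no_chain (M := D) (L := L) ui uj pj fA fB natl Rl Al Bl Cl.
  by move=> n; case: (DL n).
by case: (DL n) => _ /(_ N).
Qed.

(** * Retracts of free modules and the Eilenberg swindle *)

Section Iso.
Variable R : nzRingType.

Lemma linear_add (M N : lmodType R) (f g : {linear M -> N}) :
  exists h : {linear M -> N}, forall x, h x = f x + g x.
Proof.
apply: (@linear_pack R M N (fun x => f x + g x)) => a x y.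
by rewrite !linearP scalerDr addrACA.
Qed.

Lemma linear_sub (M N : lmodType R) (f g : {linear M -> N}) :
  exists h : {linear M -> N}, forall x, h x = f x - g x.
Proof.
apply: (@linear_pack R M N (fun x => f x - g x)) => a x y.
by rewrite (linearP f) (linearP g) scalerBr opprD addrACA.
Qed.

Lemma module_iso_trans (N M P : lmodType R) :
  module_iso M N -> module_iso N P -> module_iso M P.
Proof. by move=> [f fb] [g gb]; exists (g \o f); exact: bij_comp. Qed.

Lemma module_iso_sym (M N : lmodType R) : module_iso M N -> module_iso N M.
Proof.
move=> [f [g fK gK]].
have [h hE] : exists h : {linear N -> M}, h =1 g.
  by apply: linear_pack => a x y; apply: (can_inj fK); rewrite linearP !gK.
by exists h; exists f => x; rewrite hE ?fK ?gK.
Qed.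

Lemma split_kernel (M W : lmodType R) (e : {linear W -> M}) (p : {linear M -> W}) :
  (forall x, p (e x) = x) ->
  exists (K : lmodType R) (i : {linear K -> M}) (q : {linear M -> K}),
    [/\ forall c, q (i c) = c, forall c, p (i c) = 0, forall x, q (e x) = 0 &
        forall x, i (q x) + e (p x) = x].
Proof.
move=> pe.
have Ks : psub (fun x => p x = 0).
  by split=> [|a x y x0 y0]; rewrite ?raddf0 // linearP /= x0 y0 scaler0 addr0.
pose S : submodClosed M := psub_pred Ks.
have qS x : x - e (p x) \in S by apply/(psub_predE Ks); rewrite raddfB /= pe subrr.
have [q qE] : exists q : {linear M -> submod S}, q =1 fun x => Submod (qS x).
  apply: linear_pack => a x y; apply: val_inj; rewrite /= (linearP p) (linearP e).
  by rewrite scalerBr opprD addrACA.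
have pS (c : submod S) : p (val c) = 0.
  by apply/(psub_predE Ks); exact: submod_valP.
exists (submod S), val, q; split=> //.
- by move=> c; apply: val_inj; rewrite qE /= pS raddf0 subr0.
- by move=> x; apply: val_inj; rewrite qE /= pe subrr.
by move=> x; rewrite qE /= subrK.
Qed.

(** Mapping the basis onto K gives a free cover of K, which splits. *)
Lemma retract_cover (K : lmodType R) (lam : choiceType) : left_perfect R ->
  eqflat K -> inj_le K lam ->
  exists (s : {linear K -> {freeg lam / R}}) (p : {linear {freeg lam / R} -> K}),
    forall c, p (s c) = c.
Proof.
move=> perf fK [c ci].
have /choice[d dE] : forall x : lam, exists k, forall k', c k' = x -> k' = k.
  move=> x; have [[k kx]|nk] := pselect (exists k, c k = x).
    by exists k => k' k'x; apply: ci; rewrite kx k'x.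
  by exists 0 => k' k'x; case: nk; exists k'.
have [p pE] := fr_lift (R := R) d.
have [|s sE] := perfect_section perf (@eqflat_fr R lam) fK (p := p).
  by move=> k; exists << c k >>; rewrite pE -(dE _ k).
by exists s, p.
Qed.

End Iso.

Section Swindle.
Variables (R : nzRingType) (lam : choiceType) (K : lmodType R).
Notation P := {freeg lam / R}.
Notation W := {freeg (lam * nat)%type / R}.
Variables (s : {linear K -> P}) (pi : {linear P -> K}).
Hypothesis piK : forall c, pi (s c) = c.

(** P splits as K + K' through the idempotent eps = s pi, and W is P^(nat).  The
isomorphism puts K in front of the K-components of W by shifting them one place
up and leaves the K'-components unmoved.  With E the extension of eps to all
levels and S the shift, it is (c, p) |-> ins_0 (s c) + (p - E p) + S (E p). *)
Lemma eilenberg_swindle : module_iso (K * W)%type W.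
Proof.
have /choice[ins insE] : forall n, exists f : {linear P -> W}, forall x, f << x >> = << (x, n) >>.
  by move=> n; apply: (fr_lift (fun x => << (x, n) >> : W)).
have [pr0 pr0E] := fr_lift
  (fun p : lam * nat => if p.2 == 0%N then << p.1 >> else 0 : P).
have [E EE] := fr_lift (fun p : lam * nat => ins p.2 (s (pi << p.1 >>))).
have [S SE] := fr_lift (fun p : lam * nat => << (p.1, p.2.+1) >> : W).
have [S' S'E] := fr_lift
  (fun p : lam * nat => if p.2 is n.+1 then << (p.1, n) >> else 0 : W).
have Ein n y : E (ins n y) = ins n (s (pi y)).
  have := @fr_ext R _ _ (E \o ins n : {linear P -> W}) (ins n \o (s \o pi)).
  by move=> h; apply: h => x; rewrite /= insE EE.
have Sin n y : S (ins n y) = ins n.+1 y.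
  have := @fr_ext R _ _ (S \o ins n : {linear P -> W}) (ins n.+1).
  by move=> h; apply: h => x; rewrite /= !insE SE.
have S'in n y : S' (ins n.+1 y) = ins n y.
  have := @fr_ext R _ _ (S' \o ins n.+1 : {linear P -> W}) (ins n).
  by move=> h; apply: h => x; rewrite /= !insE S'E.
have S'in0 y : S' (ins 0%N y) = 0.
  have := @fr_ext R _ _ (S' \o ins 0%N : {linear P -> W}) \0.
  by move=> h; apply: h => x; rewrite /= !insE S'E.
have pr0in y : pr0 (ins 0%N y) = y.
  have := @fr_ext R _ _ (pr0 \o ins 0%N : {linear P -> P}) idfun.
  by move=> h; apply: h => x; rewrite /= !insE pr0E.
have pr0inS n y : pr0 (ins n.+1 y) = 0.
  have := @fr_ext R _ _ (pr0 \o ins n.+1 : {linear P -> P}) \0.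
  by move=> h; apply: h => x; rewrite /= !insE pr0E.
have EI q : E (E q) = E q.
  have := @fr_ext R _ _ (E \o E : {linear W -> W}) E.
  by move=> h; apply: h => -[x n]; rewrite /= EE Ein piK.
have ES q : E (S q) = S (E q).
  have := @fr_ext R _ _ (E \o S : {linear W -> W}) (S \o E).
  by move=> h; apply: h => -[x n]; rewrite /= SE !EE Sin.
have S'S q : S' (S q) = q.
  have := @fr_ext R _ _ (S' \o S : {linear W -> W}) idfun.
  by move=> h; apply: h => -[x n]; rewrite /= SE S'E.
have ES' q : E (S' q) = S' (E q).
  have := @fr_ext R _ _ (E \o S' : {linear W -> W}) (S' \o E).
  move=> h; apply: h => -[x [|n]]; rewrite /= S'E !EE /=.
    by rewrite raddf0 S'in0.
  by rewrite S'in.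
have pr0S q : pr0 (S q) = 0.
  have := @fr_ext R _ _ (pr0 \o S : {linear W -> P}) \0.
  by move=> h; apply: h => -[x n]; rewrite /= SE pr0E.
have pr0E' q : pr0 (E q) = s (pi (pr0 q)).
  have := @fr_ext R _ _ (pr0 \o E : {linear W -> P}) (s \o (pi \o pr0)).
  move=> h; apply: h => -[x [|n]]; rewrite /= EE pr0E /=; first exact: pr0in.
  by rewrite pr0inS !raddf0.
have SS' q : ins 0%N (pr0 q) + S (S' q) = q.
  have [T TE] := linear_add (ins 0%N \o pr0 : {linear W -> W}) (S \o S').
  rewrite -[LHS]TE.
  have := @fr_ext R _ _ T idfun.
  move=> h; apply: h => -[x [|n]]; rewrite TE /= pr0E S'E /=.
    by rewrite raddf0 addr0 insE.
  by rewrite raddf0 add0r SE.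
pose fstL : {linear (K * W)%type -> K} := fst.
pose sndL : {linear (K * W)%type -> W} := snd.
have [f1 f1E] := linear_sub sndL (E \o sndL).
have [f2 f2E] := linear_add (ins 0%N \o (s \o fstL)) f1.
have [Phi PhiE] := linear_add f2 (S \o (E \o sndL)).
exists Phi; exists (fun q => (pi (pr0 q), q - E q + S' (E q))).
  move=> [c p]; rewrite PhiE f2E f1E /=.
  set q := _ + S _.
  have pr0q : pi (pr0 q) = c.
    rewrite /q !raddfD /= !raddfN /= pr0in pr0S pr0E' raddf0 addr0.
    by rewrite !piK subrr addr0.
  have Eq : E q = ins 0%N (s c) + S (E p).
    rewrite /q !raddfD /= !raddfN /= Ein piK EI subrr addr0.
    by rewrite ES EI.
  rewrite pr0q; congr (_, _).
  rewrite Eq (raddfD S') /= S'in0 add0r S'S /q.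
  by rewrite opprD addrACA subrr addr0 [_ + (p - _)]addrC addrK subrK.
move=> q; rewrite PhiE f2E f1E /=.
have -> : E (q - E q + S' (E q)) = S' (E q).
  by rewrite (raddfD E) (raddfB E) /= EI subrr add0r ES' EI.
rewrite addrK -pr0E' addrAC.
by rewrite SS' addrC subrK.
Qed.

End Swindle.

(** * Limit models over a left perfect ring *)

Section PerfectUniv.
Variables (R : nzRingType) (lam : choiceType).
Hypothesis perf : left_perfect R.
Notation P := {freeg lam / R}.

(** If U is A plus a free module of rank lam, U is universal over A: a flat pure
extension N of A is A plus a flat module K of size at most lam, and K is a retract of the free
module. *)
Lemma split_universal_map (A U : lmodType R) (i : {linear A -> U}) (q : {linear U -> A})
    (e : {linear P -> U}) (p : {linear U -> P}) :
  (forall a, q (i a) = a) -> (forall x, p (e x) = x) ->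
  (forall x, q (e x) = 0) -> (forall a, p (i a) = 0) -> eqflat U ->
  universal_map lam i.
Proof.
move=> qi pe qe pi fU N g gi fN pg Nl.
have [r rg] := perfect_retraction perf gi pg fN.
have [K [iK [qK [qiK rK qg Nsum]]]] := split_kernel rg.
have fK : eqflat K by apply: eqflat_retract qiK fN.
have [|s [t ts]] := retract_cover perf fK (lam := lam).
  by apply: inj_le_trans Nl; exists iK; exact: can_inj qiK.
have [f fE] := linear_add (i \o r) (e \o (s \o qK)).
have [h hE] := linear_add (g \o q) (iK \o (t \o p)).
have hf x : h (f x) = x.
  rewrite hE fE /= (raddfD q) (raddfD p) /= qi qe pi pe addr0 add0r ts.
  by rewrite addrC Nsum.
exists f; split; [exact: can_inj hf|exact: split_eqpure hf|].
by move=> a; rewrite fE /= rg qg !raddf0 addr0.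
Qed.

End PerfectUniv.

Section Existence.
Variables (R : nzRingType) (lam : choiceType).
Hypothesis perf : left_perfect R.
Hypotheses (natl : inj_le nat lam) (Rl : inj_le R lam).
Notation P := {freeg lam / R}.
Notation W := {freeg (lam * nat)%type / R}.

Lemma inj_le_fr_nat : inj_le W lam.
Proof.
apply: inj_le_fr => //; apply: inj_le_trans (infinite_square natl).
by apply: inj_le_prod => //; exact: inj_le_refl.
Qed.

(** W is the union of the submodules N n of elements supported by lam x {0..n},
which are the fixed points of the truncations q n. *)
Lemma free_limit_model : limit_model (flat_pure R) lam W.
Proof.
have /choice[q qE] : forall n, exists f : {linear W -> W},
    forall u, f << u >> = if (u.2 <= n)%N then << u >> else 0.
  by move=> n; apply: (fr_lift (fun u : lam * nat => if (u.2 <= n)%N then << u >> else 0 : W)).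
have qq n k z : (k <= n)%N -> q n (q k z) = q k z.
  move=> kn.
  have := @fr_ext R _ _ (q n \o q k : {linear W -> W}) (q k).
  move=> h; apply: h => -[x l]; rewrite /= qE /=; case: ifP => lk.
    by rewrite qE /= (leq_trans lk kn).
  by rewrite raddf0.
have Ns n : psub (fun z => q n z = z).
  by split=> [|a x y xE yE]; rewrite ?raddf0 // linearP /= xE yE.
pose N n : submodClosed W := psub_pred (Ns n).
have NP n z : z \in N n <-> q n z = z by exact: (psub_predE (Ns n)).
have Nsub n k : (k <= n)%N -> {subset N k <= N n}.
  by move=> kn z /NP zk; apply/NP; rewrite -zk qq.
have qN n z : q n z \in N n by apply/NP; rewrite qq.
have prex n : exists f : {linear W -> submod (N n)}, forall z, val (f z) = q n z.
  have [f fE] : exists f : {linear W -> submod (N n)},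
      f =1 fun z => Submod (qN n z).
    by apply: linear_pack => a x y; apply: val_inj; rewrite /= linearP.
  by exists f => z; rewrite fE.
pose pr n := sval (cid (prex n)).
have prE n z : val (pr n z) = q n z by rewrite /pr; case: cid.
have prK n (z : submod (N n)) : pr n (val z) = z.
  by apply: val_inj; rewrite prE; apply/NP/submod_valP.
have fN n : eqflat (submod (N n)).
  apply: (eqflat_retract (i := val : {linear submod (N n) -> W}) (p := pr n)).
    exact: prK.
  exact: eqflat_fr.
have cN n : has_card lam (submod (N n)).
  apply: card_eqTP.
    by apply: inj_le_trans inj_le_fr_nat; exists val; exact: val_inj.
  have inN (x : lam) : << (x, 0%N) >> \in N n by apply/NP; rewrite qE.
  exists (fun x => Submod (inN x)) => x y /(congr1 val) /=.
  by move=> /fr_basis_inj[].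
have trace_split n k : (k <= n)%N ->
    exists2 r : {linear submod (N n) -> submod (trace (N n) (N k))},
      forall a, r (val a) = a & forall z, val (val (r z)) = q k (val z).
  move=> kn; have [th [_ [_ _ thE _]]] := trace_iso (Nsub _ _ kn).
  exists (th \o (pr k \o (val : {linear submod (N n) -> W}))) => [a|z] /=.
    apply: val_inj; apply: val_inj; rewrite thE prE.
    by apply/NP; exact: (submod_valP a).
  by rewrite thE prE.
have aecN n k : (k <= n)%N -> aec_le (flat_pure R) (trace (N n) (N k)).
  move=> /trace_split[r rE _]; apply/aec_leP; split; first exact: fN.
  apply: (split_eqpure (i := val : {linear submod (trace (N n) (N k)) -> submod (N n)}) (p := r)).
  exact: rE.
have univN n k : (k < n)%N ->
    universal_map lam (val : {linear submod (trace (N n) (N k)) -> submod (N n)}).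
  move=> kn; have [r rK rE] := trace_split _ _ (ltnW kn).
  have inN (x : lam) : << (x, n) >> \in N n by apply/NP; rewrite qE /= leqnn.
  have [e eE] := fr_lift (R := R) (fun x : lam => Submod (inN x)).
  have [p0 p0E] := fr_lift
    (fun u : lam * nat => if u.2 == n then << u.1 >> else 0 : P).
  apply: (@split_universal_map R lam perf _ _ val r e (p0 \o val)); last exact: fN.
  - exact: rK.
  - move=> x.
    have := @fr_ext R _ _ (p0 \o (val \o e) : {linear P -> P}) idfun.
    by move=> h; apply: h => y; rewrite /= eE /= p0E eqxx.
  - move=> x; apply: val_inj; apply: val_inj; rewrite rE.
    have := @fr_ext R _ _ (q k \o (val \o e) : {linear P -> W}) \0.
    by move=> h; apply: h => y; rewrite /= eE /= qE /= leqNgt kn.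
  - move=> a /=; have /NP <- : val (val a) \in N k by exact: (submod_valP a).
    have := @fr_ext R _ _ (p0 \o q k : {linear W -> P}) \0.
    move=> h; apply: h => -[y l]; rewrite /= qE /=; case: ifP => lk; last exact: raddf0.
    by rewrite p0E /= ltn_eqF // (leq_ltn_trans lk kn).
have ctr n k : (k <= n)%N -> has_card lam (submod (trace (N n) (N k))).
  move=> kn; have [th [ph [thK phK _ _]]] := trace_iso (Nsub _ _ kn).
  have /card_eqPle[/card_leTP a /card_leTP b] := cN k.
  apply: card_eqTP.
    by apply: inj_le_trans a; exists ph; exact: can_inj phK.
  by apply: inj_le_trans b _; exists th; exact: can_inj thK.
exists nat, leq, N; split.
- split; last exact/card_leTP.
  split=> [A [x xA]||i].
  + have exA : exists n, n \in A by exists x.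
    case: (ex_minnP exA) => n nA nmin; exists n; split.
      by split=> // k kA; exact: nmin.
    move=> k [kA kmin]; apply/eqP; rewrite eqn_leq; apply/andP; split.
      exact: nmin.
    exact: kmin.
  + by split; exact: 0%N.
  by exists i.+1; rewrite /slt leqnSn andbT neq_ltn leqnn.
- by move=> i; split; [exact/flatP|].
- by move=> i j ij; split; [exact: Nsub|exact: aecN].
- move=> j [[i ij] jlim].
  case: j ij jlim => [|j] ij jlim; first by move: ij; rewrite /slt leqn0 andNb.
  have [|k [jk kj]] := jlim j; first by rewrite /slt leqnSn andbT neq_ltn leqnn.
  move: jk kj; rewrite /slt -!ltn_neqAle => jk.
  by rewrite ltnS leqNgt jk.
split=> [z|i j [ij _]].
  have [k zk] : exists k, forall u, u \in dom z -> (u.2 <= k)%N.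
    exists (\max_(u <- dom z) u.2)%N => u uz.
    by apply: (leq_bigmax_seq (P := xpredT) (F := fun u : lam * nat => u.2)).
  exists k; apply/NP; rewrite [in LHS](fr_sum z) linear_sum [RHS](fr_sum z).
  by rewrite !big_seq; apply: eq_bigr => u uz; rewrite linearZ /= qE zk.
have {}ij : (i < j)%N by move: ij; rewrite /slt -ltn_neqAle.
split; [exact/aecN/ltnW|exact: cN|exact/ctr/ltnW|].
move=> N' g /aec_embeddingP[gi fN' pg] /card_leTP N'l.
have [f [fi pf fg]] := univN j i ij N' g gi fN' pg N'l.
by exists f; split=> //; apply/aec_embeddingP; split=> //; exact: fN.
Qed.

End Existence.

Lemma well_order_total (T : eqType) (le : rel T) : well_order le -> total le.
Proof.
move=> wo x y; have [|z [[zA zmin] _]] := wo (mem [pred u | (u == x) || (u == y)]).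
  by exists x; rewrite inE eqxx.
have zx : le z x by apply: zmin; rewrite inE eqxx.
have zy : le z y by apply: zmin; rewrite inE eqxx orbT.
by case/orP: zA zx zy => /eqP -> zx zy; rewrite ?zx ?zy ?orbT.
Qed.

Section Uniqueness.
Variables (R : nzRingType) (lam : choiceType).
Hypothesis perf : left_perfect R.
Hypotheses (natl : inj_le nat lam) (Rl : inj_le R lam).
Notation W := {freeg (lam * nat)%type / R}.

(** The first universal step of the chain contains N_0 + W, so W is a pure submodule
and then a summand of M; what remains is absorbed by the swindle. *)
Lemma limit_model_free (M : lmodType R) :
  limit_model (flat_pure R) lam M -> module_iso M W.
Proof.
move=> [I [le [N [[lim /card_leTP Il] hN le_sub _ [hM hS]]]]].
have [wo [i0] _] := lim; have tot := well_order_total wo.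
have [i1 s01] := succ_exists lim i0.
have fN i : eqflat (submod (N i)) by have [/flatP] := hN i.
have cN i : inj_le (submod (N i)) lam by have [_ /card_eq_inj_le] := hN i.
have lexx i : le i i by have := tot i i; rewrite orbb.
have sub i j : le i j -> {subset N i <= N j} by move=> /le_sub[].
(* Finitely many elements of M lie in a single N i, so that the equational
   properties pass from the N i to M. *)
have cover0 m (h : tup M m) : exists i, forall l, h l \in N i.
  elim: m h => [|m IH] h; first by exists i1 => -[].
  have [i hi] := IH [ffun l => h (fintype.lift ord0 l)].
  have [j hj] := hM (h ord0).
  have hil l : h (fintype.lift ord0 l) \in N i by have := hi l; rewrite ffunE.
  case/orP: (tot i j) => ij; [exists j|exists i] => l.
    by case: (unliftP ord0 l) => [l' ->|->] //; exact: sub ij _ (hil l').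
  by case: (unliftP ord0 l) => [l' ->|->] //; exact: sub ij _ hj.
have cover m (h : tup M m) : exists2 i, le i1 i & forall l, h l \in N i.
  have [i hi] := cover0 _ h; case/orP: (tot i1 i) => h1; first by exists i.
  by exists i1 => // l; exact: sub h1 _ (hi l).
have restr m (h : tup M m) : exists2 i, le i1 i &
    exists h' : tup (submod (N i)) m, vmap (val : {linear submod (N i) -> M}) h' = h.
  have [i i1i hi] := cover _ h; exists i => //.
  by exists [ffun l => Submod (hi l)]; apply/ffunP => l; rewrite !ffunE.
have fM : eqflat M.
  move=> m r g rg; have [i _ [g' gE]] := restr _ g.
  have [|k [L [y [gy rL]]]] := fN i m r g'.
    by apply: (vmap_inj (f := val) val_inj); rewrite vmapM gE rg vmap0.
  by exists k, L, (vmap val y); rewrite -vmapM -gy gE.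
have p1 : eqpure (val : {linear submod (N i1) -> M}).
  move=> m k A s h e; have [i i1i [h' hE]] := restr _ h.
  have [sub1 /aec_leP[_ ptr]] := le_sub _ _ i1i.
  have [th [ph [thK phK thE phE]]] := trace_iso sub1.
  have [|t tE] := ptr m k A (vmap th s) h'.
    apply: (vmap_inj (f := val) val_inj); rewrite vmapM hE -e.
    by apply/ffunP => l; rewrite !ffunE /= thE.
  by exists (vmap ph t); rewrite -vmapM -tE vmap_id.
(* An element is coded by the index of a member of the chain containing it and
   its code there. *)
have Ml : inj_le M lam.
  have /choice[ix ixP] := hM.
  have /choice[c cP] : forall i, exists c : M -> lam, {in N i &, injective c}.
    move=> i; have [c ci] := cN i; have [e ei] := natl.
    exists (fun x => if insub x is Some y then c (y : submod (N i)) else e 0%N).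
    by move=> x y xN yN; rewrite !insubT => /ci [].
  apply: (@inj_le_trans (lam * lam)); last exact: infinite_square.
  have [d di] := Il; exists (fun x => (d (ix x), c (ix x) x)) => x y [/di ixy].
  by rewrite ixy; apply: cP; rewrite // -ixy.
have [u01 f1 p01 c1] := universal_over_map (hS _ _ s01).
set A := submod (trace (N i1) (N i0)) in u01.
have fA : eqflat A by apply: eqflat_pure p01 f1; exact: val_inj.
have Al : inj_le A lam by apply: inj_le_trans c1; exists val; exact: val_inj.
have [g0 [g1 [g0E g1E]]] := linear_pair A W.
have [f [fi fp _]] : exists f : {linear (A * W)%type -> submod (N i1)},
    [/\ injective f, eqpure f & forall a, f (g0 a) = val a].
  apply: u01.
  - by move=> a b; rewrite !g0E => -[].
  - by apply: eqflat_prod => //; exact: eqflat_fr.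
  - by apply: (split_eqpure (p := (fst : {linear (A * W)%type -> A}))) => a; rewrite g0E.
  apply: inj_le_trans (infinite_square natl); apply: inj_le_prod => //.
  exact: inj_le_fr_nat.
pose e : {linear W -> M} := val \o (f \o g1).
have ei : injective e.
  by move=> x y /val_inj /fi; rewrite !g1E => -[].
have ep : eqpure e.
  apply: (eqpure_comp (f := f \o g1)) p1 => //.
  apply: (eqpure_comp (f := g1)) fp => //.
  by apply: (split_eqpure (p := (snd : {linear (A * W)%type -> W}))) => a; rewrite g1E.
have [p pe] := perfect_retraction perf ei ep fM.
have [K [i [q [qi pi qe Msum]]]] := split_kernel pe.
have fK : eqflat K by apply: eqflat_retract qi fM.
have [|s [t ts]] := retract_cover perf fK (lam := lam).
  by apply: inj_le_trans Ml; exists i; exact: can_inj qi.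
apply: module_iso_trans (eilenberg_swindle ts).
have [h hE] : exists h : {linear M -> (K * W)%type}, h =1 fun x => (q x, p x).
  by apply: linear_pack => a x y; rewrite !linearP.
exists h; exists (fun u => i u.1 + e u.2) => [x|[c w]]; rewrite hE /=.
  exact: Msum.
by rewrite !raddfD /= qi qe pi pe addr0 add0r.
Qed.

End Uniqueness.

Theorem left_perfect_superstable (R : nzRingType) :
  left_perfect R -> superstable (flat_pure R).
Proof.
move=> perf; exists ((R + nat)%type : choiceType); split.
  exact/card_leTP/inj_le_refl.
move=> lam /card_leTP mul.
have Rl : inj_le R lam.
  by apply: inj_le_trans mul; exists (fun r : R => inl r : R + nat)%type => x y [].
have natl : inj_le nat lam.
  by apply: inj_le_trans mul; exists (fun n : nat => inr n : R + nat)%type => x y [].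
split; first by exists {freeg (lam * nat)%type / R}; exact: free_limit_model.
move=> M M' /(limit_model_free perf natl Rl) MW /(limit_model_free perf natl Rl) MW'.
by apply: module_iso_trans MW _; exact: module_iso_sym.
Qed.

Theorem corollary5p16 (R : nzRingType) :
  superstable (flat_pure R) <-> left_perfect R.
Proof.
split; [exact: superstable_left_perfect|exact: left_perfect_superstable].
Qed.
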